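(* The QTSP linearization problem can be solved in $O(n^5)$ time: there is an algorithm that, given $Q \in \mathbb{M}^{n(n-1)}$, decides in $O(n^5)$ time whether $Q$ is linearizable, and whenever $Q$ is linearizable, constructs a linearization $C \in \mathbb{M}^n$ of $Q$ in $O(n^5)$ time.
   Context: Let $N = \{1,\dots,n\}$ and $E = \{(i,j) : i,j\in N,\ i\ne j\}$ the arc set of the complete directed graph on $N$. A tour is a directed Hamiltonian cycle in this graph, identified with its arc set; $\mathcal{T}_n$ is the set of tours. $\mathbb{M}^n$ is the space of real $n\times n$ matrices indexed by $N$; $\mathbb{M}^{n(n-1)}$ is the space of real matrices with rows and columns indexed by $E$, with entry $q_{ijk\ell}$ in row $(i,j)$ and column $(k,\ell)$. For $\tau\in\mathcal{T}_n$, $Q[\tau] := \sum_{(e,f)\in\tau\times\tau} q_{ef}$ and $C(\tau) := \sum_{(i,j)\in\tau} c_{ij}$. $Q$ is linearizable if there exists $C\in\mathbb{M}^n$ with $Q[\tau]=C(\tau)$ for all $\tau\in\mathcal{T}_n$; such a $C$ is a linearization. The QTSP linearization problem: given $Q$, verify whether it is linearizable and, if yes, compute a linearization. Running time is measured in arithmetic operations. *)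

(* Defs.v *)
From HB Require Import structures.
From mathcomp Require Import all_boot all_order all_algebra.
From mathcomp Require Import reals.

Set Implicit Arguments.
Unset Strict Implicit.
Unset Printing Implicit Defensive.

Import GRing.Theory Num.Theory.

Local Open Scope ring_scope.

(* Vertices are 'I_n, that is 0, ..., n-1 instead of 1, ..., n. *)
Definition diarc (n : nat) : Type := {e : 'I_n * 'I_n | e.1 != e.2}.

Definition arc_tail (n : nat) (e : diarc n) : 'I_n := (val e).1.
Definition arc_head (n : nat) (e : diarc n) : 'I_n := (val e).2.

(* A tour is the arc set of a directed Hamiltonian cycle visiting the vertices
   in the cyclic order s.  [cycle] asks consecutive vertices, cyclically, to be
   distinct: there is no tour for n = 1, and one tour (of two arcs) for n = 2. *)
Definition is_tour (n : nat) (tau : {set diarc n}) : Prop :=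
  exists s : seq 'I_n,
    [/\ ucycle [rel i j : 'I_n | i != j] s, size s = n
      & tau = [set e | arc_head e == next s (arc_tail e)]].

Definition quad_cost (R : realType) (n : nat)
    (Q : {ffun diarc n * diarc n -> R}) (tau : {set diarc n}) : R :=
  \sum_(ef in setX tau tau) Q ef.

Definition lin_cost (R : realType) (n : nat)
    (C : 'M[R]_n) (tau : {set diarc n}) : R :=
  \sum_(e in tau) C (arc_tail e) (arc_head e).

Definition is_linearization (R : realType) (n : nat)
    (Q : {ffun diarc n * diarc n -> R}) (C : 'M[R]_n) : Prop :=
  forall tau : {set diarc n}, is_tour tau -> quad_cost Q tau = lin_cost C tau.

Definition linearizable (R : realType) (n : nat)
    (Q : {ffun diarc n * diarc n -> R}) : Prop :=
  exists C : 'M[R]_n, is_linearization Q C.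

(* Algorithms are programs for a real random access machine.  Memory consists
   of integer arrays and real arrays, named by natural numbers; an array cell is
   addressed by a list of indices, and a scalar variable is the cell [::].
   Indices are computed from integer cells only, and no operation takes a real
   to an integer (no rounding): reals influence control flow only through
   comparisons.  A program is a finite object that contains no real constant and
   does not depend on the size of the input. *)

Inductive iexpr : Type :=
  | IConst of nat
  | IGet of nat & seq iexpr
  | IAdd of iexpr & iexpr
  | ISub of iexpr & iexpr.

Inductive rexpr : Type :=
  | ROfInt of iexpr
  | RGet of nat & seq iexpr
  | RAdd of rexpr & rexpr
  | RSub of rexpr & rexpr
  | RMul of rexpr & rexpr
  | RDiv of rexpr & rexpr.

Inductive test : Type :=
  | TILe of iexpr & iexpr
  | TRLe of rexpr & rexpr
  | TNot of test
  | TAnd of test & test.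

Inductive cmd : Type :=
  | Skip
  | ISet of nat & seq iexpr & iexpr
  | RSet of nat & seq iexpr & rexpr
  | Seq of cmd & cmd
  | If of test & cmd & cmd
  | While of test & cmd.

Record store (R : realType) : Type := Store {
  int_mem : nat -> seq nat -> nat;
  real_mem : nat -> seq nat -> R
}.

Definition update (T : Type) (m : nat -> seq nat -> T)
    (a : nat) (ix : seq nat) (v : T) : nat -> seq nat -> T :=
  fun b jx => if (b == a) && (jx == ix) then v else m b jx.

(* Integer subtraction is truncated at 0. *)
Fixpoint ieval (R : realType) (s : store R) (e : iexpr) : nat :=
  match e with
  | IConst k => k
  | IGet a ix => int_mem s a (map (ieval s) ix)
  | IAdd e1 e2 => (ieval s e1 + ieval s e2)%N
  | ISub e1 e2 => (ieval s e1 - ieval s e2)%N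
  end.

(* Division by zero yields 0. *)
Fixpoint reval (R : realType) (s : store R) (e : rexpr) : R :=
  match e with
  | ROfInt e1 => (ieval s e1)%:R
  | RGet a ix => real_mem s a (map (ieval s) ix)
  | RAdd e1 e2 => reval s e1 + reval s e2
  | RSub e1 e2 => reval s e1 - reval s e2
  | RMul e1 e2 => reval s e1 * reval s e2
  | RDiv e1 e2 => reval s e1 / reval s e2
  end.

Fixpoint teval (R : realType) (s : store R) (b : test) : bool :=
  match b with
  | TILe e1 e2 => (ieval s e1 <= ieval s e2)%N
  | TRLe e1 e2 => reval s e1 <= reval s e2
  | TNot b1 => ~~ teval s b1
  | TAnd b1 b2 => teval s b1 && teval s b2
  end.

(* Every constant, memory access, arithmetic operation (on reals as well as on
   indices), comparison and control step is charged one unit. *)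
Fixpoint icost (e : iexpr) : nat :=
  match e with
  | IConst _ => 1
  | IGet _ ix => (sumn (map icost ix)).+1
  | IAdd e1 e2 | ISub e1 e2 => (icost e1 + icost e2).+1
  end.

Fixpoint rcost (e : rexpr) : nat :=
  match e with
  | ROfInt e1 => (icost e1).+1
  | RGet _ ix => (sumn (map icost ix)).+1
  | RAdd e1 e2 | RSub e1 e2 | RMul e1 e2 | RDiv e1 e2 =>
      (rcost e1 + rcost e2).+1
  end.

Fixpoint tcost (b : test) : nat :=
  match b with
  | TILe e1 e2 => (icost e1 + icost e2).+1
  | TRLe e1 e2 => (rcost e1 + rcost e2).+1
  | TNot b1 => (tcost b1).+1
  | TAnd b1 b2 => (tcost b1 + tcost b2).+1
  end.

(* [exec c s t s'] : started in store s, the program c halts after time t in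
   store s'. *)
Inductive exec (R : realType) : cmd -> store R -> nat -> store R -> Prop :=
  | ExecSkip s : exec Skip s 1 s
  | ExecISet s a ix e :
      exec (ISet a ix e) s (sumn (map icost ix) + icost e).+1
        (Store (update (int_mem s) a (map (ieval s) ix) (ieval s e))
               (real_mem s))
  | ExecRSet s a ix e :
      exec (RSet a ix e) s (sumn (map icost ix) + rcost e).+1
        (Store (int_mem s)
               (update (real_mem s) a (map (ieval s) ix) (reval s e)))
  | ExecSeq c1 c2 s1 t1 s2 t2 s3 :
      exec c1 s1 t1 s2 -> exec c2 s2 t2 s3 ->
      exec (Seq c1 c2) s1 (t1 + t2) s3
  | ExecIf b c1 c2 s t s' :
      exec (if teval s b then c1 else c2) s t s' ->
      exec (If b c1 c2) s (tcost b + t).+1 s'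
  | ExecWhileStop b c s :
      ~~ teval s b -> exec (While b c) s (tcost b).+1 s
  | ExecWhileStep b c s1 t1 s2 t2 s3 :
      teval s1 b -> exec c s1 t1 s2 -> exec (While b c) s2 t2 s3 ->
      exec (While b c) s1 (tcost b + t1 + t2).+1 s3.

(* Input: integer scalar 0 holds n and cell [i; j; k; l] of real array 0 holds
   the entry of Q in row (i, j) and column (k, l).  All other cells of the
   initial memory are arbitrary. *)
Definition holds_input (R : realType) (n : nat)
    (Q : {ffun diarc n * diarc n -> R}) (s : store R) : Prop :=
  int_mem s 0 [::] = n /\
  forall e f : diarc n,
    real_mem s 0 [:: val (arc_tail e); val (arc_head e);
                     val (arc_tail f); val (arc_head f)] = Q (e, f).

(* Output: the answer is "yes" iff integer scalar 1 is nonzero; the matrix is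
   read off cells [i; j] of real array 1. *)
Definition answers_yes (R : realType) (s : store R) : bool :=
  int_mem s 1 [::] != 0%N.

Definition output_matrix (R : realType) (n : nat) (s : store R) : 'M[R]_n :=
  \matrix_(i < n, j < n) real_mem s 1 [:: val i; val j].

(* Main.v *)
Require Import Defs.
From HB Require Import structures.
From mathcomp Require Import all_boot all_order all_algebra.
From mathcomp Require Import reals zify ring lra.

(* Symmetrize Q and eliminate the arcs at vertex 0 by means of the degree
   equations; what remains is a quadratic cost g on the Hamiltonian paths of the
   other vertices.  Second differences of such a cost along two independent
   rearrangements of a path must vanish if the cost is linear.  For large n this
   forces, on every small set of vertices,
     g(ij, km) = u(ij) + u(km) + A(ik) + D(jm)            for i, j, k, m distinct,
     g(ij, jm) = u(ij) + u(jm) + A(ij) + D(jm) + t(j)     for i, j, m distinct,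
   and u, A, D, t can be computed, up to an irrelevant gauge, from O(1) entries of
   g each.  Conversely, if the values so computed satisfy these equations, then Q
   splits as a(ij, k) + b(ij, m) + a(km, i) + b(km, j) on all pairs of compatible
   arcs ij, km, and summing over the tails and the heads of a tour gives a
   linearization.  This takes O(n^4) operations.  The finitely many remaining n
   are treated by programs without loops that solve a fixed rational linear
   system. *)

Set Implicit Arguments.
Unset Strict Implicit.
Unset Printing Implicit Defensive.

Import Order.TTheory GRing.Theory Num.Theory.
Local Open Scope ring_scope.

(** * Quadratic costs on Hamiltonian paths *)

(** The structure result is local: its coefficients exist for one small set of vertices at a time,
    and different sets may yield different ones. Nothing is glued. Each candidate formula reads [g]
    only at its own indices and at the vertices 1, ..., 8, so for a given quadruple everything can
    be evaluated inside a single set containing all of these, where the candidate differs from the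
    local solution by a change of gauge only. A large n supplies these reference vertices and the
    auxiliary vertices outside the set. Vertex 0 serves as the cut point of tours. Once its arcs are
    eliminated, blocks of the remaining path can be interchanged and its ends rearranged; the arcs
    at 0 then occur on the linear side only, where they drop out of second differences. The machine
    model shapes the rest: real expressions have no conditionals, so case distinctions become 0-1
    factors, and one comparison of a sum of squares with 0 decides a whole system of equations. *)

Definition arcs (s : seq nat) : seq (nat * nat) := zip s (behead s).

Lemma arcs_cat (s t : seq nat) (y : nat) :
  arcs (s ++ y :: t) = arcs (rcons s y) ++ arcs (y :: t).
Proof.
elim: s => [|x [|x' s] IHs] //.
by move: IHs; rewrite /arcs /= => ->.
Qed.

Lemma arcs_rcons2 (s : seq nat) (x y : nat) :
  arcs (rcons (rcons s x) y) = rcons (arcs (rcons s x)) (x, y).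
Proof. by rewrite -[RHS]cats1 -[rcons (rcons _ _) _]cats1 cat_rcons arcs_cat. Qed.

Section Pairing.
Variables (R : realType) (g : nat -> nat -> nat -> nat -> R).

Definition pairing (c d : seq (nat * nat)) : R :=
  \sum_(e <- c) \sum_(f <- d) g e.1 e.2 f.1 f.2.

Lemma pairing_catl c c' d : pairing (c ++ c') d = pairing c d + pairing c' d.
Proof. by rewrite /pairing big_cat. Qed.

Lemma pairing_catr c d d' : pairing c (d ++ d') = pairing c d + pairing c d'.
Proof. by rewrite /pairing -big_split; apply: eq_bigr => e _; rewrite big_cat. Qed.

Lemma pairing_consl e c d : pairing (e :: c) d = pairing [:: e] d + pairing c d.
Proof. by rewrite -cat1s pairing_catl. Qed.

Lemma pairing_consr c e d : pairing c (e :: d) = pairing c [:: e] + pairing c d.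
Proof. by rewrite -cat1s pairing_catr. Qed.

Lemma pairing1 e f : pairing [:: e] [:: f] = g e.1 e.2 f.1 f.2.
Proof. by rewrite /pairing !big_seq1. Qed.

Lemma pairingC c d : (forall i j k l, g i j k l = g k l i j) ->
  pairing c d = pairing d c.
Proof.
move=> gC; rewrite /pairing exchange_big; apply: eq_bigr => e _.
by apply: eq_bigr => f _; rewrite gC.
Qed.

End Pairing.

Ltac split_uniq :=
  repeat match goal with
  | H : is_true (_ && _) |- _ => case/andP: H => ? ?
  | H : is_true (uniq (_ :: _)) |- _ => rewrite /= in H
  | H : is_true (all _ (_ :: _)) |- _ => rewrite /= in H
  | H : is_true (~~ (in_mem _ (mem (_ :: _)))) |- _ => rewrite !inE ?negb_or in H
  end.
Ltac distinct :=
  rewrite /= ?inE ?negb_or ?andbT;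
  repeat match goal with |- is_true (_ && _) => apply/andP; split end;
  match goal with
  | H : is_true ?P |- is_true ?P => exact H
  | H : is_true (?x != ?y) |- is_true (?y != ?x) => rewrite eq_sym; exact H
  | |- _ => idtac
  end.

Section HamiltonianPaths.

(* [g] is a quadratic cost on the Hamiltonian paths of 1, ..., n-1 that agrees
   with a linear cost; [l] also sees the end points, through the arcs at 0. *)
Variables (R : realType) (n : nat).
Variables (g : nat -> nat -> nat -> nat -> R) (l : nat * nat -> R).
Hypothesis gC : forall i j k m, g i j k m = g k m i j.
Hypothesis gl : forall p, perm_eq p (iota 1 n.-1) ->
  pairing g (arcs p) (arcs p) = \sum_(e <- arcs (0%N :: rcons p 0%N)) l e.

Definition inner (v : nat) := (0 < v < n)%N.
Arguments inner : simpl never.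

(** There are n - 1 inner vertices, hence the strict bound. *)
Lemma fresh_seq (k : nat) (L : seq nat) : (size L + k < n)%N ->
  exists s, [/\ size s = k, uniq s, all inner s & all [predC mem L] s].
Proof.
move=> sz; exists (take k [seq v <- iota 1 n.-1 | v \notin L]).
have szf : (k <= size [seq v <- iota 1 n.-1 | v \notin L])%N.
  have := count_predC (mem L) (iota 1 n.-1); rewrite size_iota.
  have : (count (mem L) (iota 1 n.-1) <= size L)%N.
    rewrite -size_filter; apply: uniq_leq_size; first by rewrite filter_uniq ?iota_uniq.
    by move=> x; rewrite mem_filter => /andP[].
  rewrite size_filter (@eq_count _ (predC (mem L)) (fun v => v \notin L)) //.
  by move: sz; clear; move: (count _ _) (count _ _) (size L) => a b c; lia.
split.
- by rewrite size_takel.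
- by rewrite take_uniq // filter_uniq // iota_uniq.
- apply/allP => x /mem_take; rewrite mem_filter mem_iota /inner => /andP[_].
  by lia.
- by apply/allP => x /mem_take; rewrite mem_filter => /andP[].
Qed.

(** Identities between a few vertices are proved on whole Hamiltonian paths; the other vertices go
    into a block that is held fixed. *)
Lemma complete_path (L : seq nat) : uniq L -> all inner L ->
  exists m, perm_eq (L ++ m) (iota 1 n.-1).
Proof.
move=> uL iL; exists [seq v <- iota 1 n.-1 | v \notin L].
apply: uniq_perm; last 1 first.
- move=> x; rewrite mem_cat mem_filter; case: (boolP (x \in L)) => [xL|] //=.
  by move/allP: iL => /(_ _ xL); rewrite mem_iota /inner; lia.
- rewrite cat_uniq uL filter_uniq ?iota_uniq // andbT.
  by apply/hasPn => x; rewrite mem_filter => /andP[].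
- exact: iota_uniq.
Qed.

Lemma arcs_sum_path (p : seq nat) (x y : nat) :
  \sum_(e <- arcs (0%N :: x :: rcons (rcons p y) 0%N)) l e
  = l (0%N, x) + \sum_(e <- arcs (x :: rcons p y)) l e + l (y, 0%N).
Proof.
have -> : arcs (0%N :: x :: rcons (rcons p y) 0%N)
    = (0%N, x) :: rcons (arcs (x :: rcons p y)) (y, 0%N).
  by have := arcs_rcons2 (x :: p) y 0%N; rewrite /arcs /= => ->.
by rewrite big_cons -cats1 big_cat big_seq1 /= addrA.
Qed.

(* The paths X Y and Y X differ in the single arc e or f that joins the two
   blocks, so the second difference against a rearrangement of X is bilinear. *)
Lemma rotation_identity (p r p' r' : nat) (X X' Y : seq nat) :
  perm_eq X X' ->
  perm_eq ((r' :: rcons X p) ++ (r :: rcons Y p')) (iota 1 n.-1) ->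
  pairing g [:: (p, r)] (arcs (r' :: rcons X p))
    - pairing g [:: (p', r')] (arcs (r' :: rcons X p))
  = pairing g [:: (p, r)] (arcs (r' :: rcons X' p))
    - pairing g [:: (p', r')] (arcs (r' :: rcons X' p)).
Proof.
move=> XX' pXY.
(* Subtracting the equations of the two block orders cancels all costs within the blocks; the
   right-hand side does not mention [Z]. *)
have half Z : perm_eq Z X ->
    2 * (pairing g [:: (p, r)] (arcs (r' :: rcons Z p))
    - pairing g [:: (p', r')] (arcs (r' :: rcons Z p))) =
    l (0%N, r') + l (p, r) + l (p', 0%N) - l (0%N, r) - l (p', r') - l (p, 0%N)
    - g p r p r + g p' r' p' r'
    - 2 * (pairing g [:: (p, r)] (arcs (r :: rcons Y p'))
    - pairing g [:: (p', r')] (arcs (r :: rcons Y p'))).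
  move=> ZX.
  have pZY : perm_eq ((r' :: rcons Z p) ++ (r :: rcons Y p')) (iota 1 n.-1).
    apply: perm_trans pXY; rewrite perm_cat2r perm_cons -!cats1 perm_cat2r //.
  have pYZ : perm_eq ((r :: rcons Y p') ++ (r' :: rcons Z p)) (iota 1 n.-1).
    by rewrite perm_catC.
  have join a b c d A B : arcs ((a :: rcons A b) ++ (c :: rcons B d))
      = arcs (a :: rcons A b) ++ (b, c) :: arcs (c :: rcons B d).
    by rewrite arcs_cat -rcons_cons arcs_rcons2 cat_rcons.
  have lsum a b c d A B :
      \sum_(e <- arcs (0%N :: rcons ((a :: rcons A b) ++ (c :: rcons B d)) 0%N)) l e
      = l (0%N, a) + \sum_(e <- arcs (a :: rcons A b)) l e + l (b, c)
        + \sum_(e <- arcs (c :: rcons B d)) l e + l (d, 0%N).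
    have -> : 0%N :: rcons ((a :: rcons A b) ++ (c :: rcons B d)) 0%N
        = 0%N :: a :: rcons (rcons ((rcons A b) ++ c :: B) d) 0%N.
      by rewrite [in RHS]rcons_cat.
    rewrite arcs_sum_path.
    have -> : a :: rcons (rcons A b ++ c :: B) d
      = (a :: rcons A b) ++ (c :: rcons B d) by rewrite rcons_cat.
    by rewrite join big_cat big_cons /= !addrA.
  have := gl pYZ; have := gl pZY; rewrite !lsum !join.
  rewrite !(pairing_catl, pairing_catr) !(pairing_consl _ (_, _) (arcs _)).
  rewrite !(pairing_consr _ _ (_, _) (arcs _)) !pairing1.
  rewrite (pairingC (arcs (r :: _)) (arcs (r' :: _)) gC).
  rewrite !(pairingC (arcs _) [:: _] gC) /=.
  lra.
have XX : perm_eq X X by [].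
have := half _ XX; have : perm_eq X' X by rewrite perm_sym.
move=> /half; lra.
Qed.

(** Each swap alters the arcs at one end of the path. Costs within one end, costs against the fixed
    middle and all linear costs depend on one swap alone, so the second difference retains only the
    costs between the two ends. *)
Lemma endswap_identity (i i' j k m m' : nat) :
  uniq [:: i; i'; j; k; m; m'] -> all inner [:: i; i'; j; k; m; m'] ->
  pairing g [:: (i, i'); (i', j)] [:: (k, m); (m, m')]
  - pairing g [:: (i', i); (i, j)] [:: (k, m); (m, m')]
  - pairing g [:: (i, i'); (i', j)] [:: (k, m'); (m', m)]
  + pairing g [:: (i', i); (i, j)] [:: (k, m'); (m', m)] = 0.
Proof.
move=> uL iL; have [M pM] := complete_path uL iL.
have key a a' b b' : perm_eq [:: a; a'] [:: i; i'] -> perm_eq [:: b; b'] [:: m; m'] ->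
    pairing g [:: (a, a'); (a', j)] [:: (a, a'); (a', j)]
    + pairing g [:: (k, b); (b, b')] [:: (k, b); (b, b')]
    + 2 * pairing g [:: (a, a'); (a', j)] [:: (k, b); (b, b')]
    + 2 * pairing g [:: (a, a'); (a', j)] (arcs (j :: rcons M k))
    + 2 * pairing g [:: (k, b); (b, b')] (arcs (j :: rcons M k))
    + pairing g (arcs (j :: rcons M k)) (arcs (j :: rcons M k))
    = l (0%N, a) + l (a, a') + l (a', j)
      + \sum_(e <- arcs (j :: rcons M k)) l e + l (k, b) + l (b, b') + l (b', 0%N).
  move=> pa pb.
  have pp : perm_eq (a :: rcons ([:: a', j & M] ++ [:: k; b]) b') (iota 1 n.-1).
    apply: perm_trans pM; rewrite /= -cats1 -!catA /=.
    have -> : [:: a, a', j & M ++ [:: k; b; b']]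
      = [:: a; a'] ++ ([:: j] ++ M ++ [:: k]) ++ [:: b; b'] by rewrite /= -catA.
    have -> : [:: i, i', j, k, m, m' & M]
      = [:: i; i'] ++ ([:: j; k; m; m'] ++ M) by [].
    apply: perm_cat => //; rewrite perm_sym.
    rewrite -[[:: j; k; m; m'] ++ M]/([:: j] ++ ([:: k] ++ ([:: m; m'] ++ M))).
    rewrite -catA perm_cat2l catA.
    apply: (@perm_trans _ (M ++ [:: k] ++ [:: m; m'])).
      by rewrite catA perm_catC catA.
    by rewrite catA; apply: perm_cat => //; rewrite perm_sym.
  have Earcs : arcs (a :: rcons ([:: a', j & M] ++ [:: k; b]) b')
      = [:: (a, a'); (a', j)] ++ arcs (j :: rcons M k) ++ [:: (k, b); (b, b')].
    have -> : a :: rcons ([:: a', j & M] ++ [:: k; b]) b'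
      = [:: a; a'] ++ (j :: (M ++ k :: [:: b; b'])).
      by rewrite /= -cats1 -catA.
    rewrite arcs_cat; congr (_ ++ _).
    by rewrite -cat_cons arcs_cat.
  have := gl pp; rewrite (rcons_cons a) arcs_sum_path Earcs.
  rewrite !(pairing_catl, pairing_catr) !big_cat /= !big_cons !big_nil.
  rewrite !(pairingC (arcs _) [:: _; _] gC).
  rewrite !(pairingC [:: (k, b); (b, b')] [:: (a, a'); (a', j)] gC).
  lra.
have Ci : perm_eq [:: i'; i] [:: i; i'] by rewrite (perm_catC [:: i'] [:: i]).
have Cm : perm_eq [:: m'; m] [:: m; m'] by rewrite (perm_catC [:: m'] [:: m]).
have := key _ _ _ _ (perm_refl [:: i; i']) (perm_refl [:: m; m']).
have := key _ _ _ _ Ci (perm_refl [:: m; m']).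
have := key _ _ _ _ (perm_refl [:: i; i']) Cm.
have := key _ _ _ _ Ci Cm.
lra.
Qed.

End HamiltonianPaths.

(** * The shape of a path cost on a small set of vertices *)

Section LocalStructure.

Variables (R : realType) (n : nat).
Variables (g : nat -> nat -> nat -> nat -> R) (l : nat * nat -> R).
Hypothesis gC : forall i j k m, g i j k m = g k m i j.
Hypothesis gl : forall p, perm_eq p (iota 1 n.-1) ->
  pairing g (arcs p) (arcs p) = \sum_(e <- arcs (0%N :: rcons p 0%N)) l e.

Local Notation inner := (inner n).

Lemma rotation_identity_inner (p r p' r' : nat) (X X' : seq nat) :
  perm_eq X X' -> uniq (r' :: rcons X p ++ [:: r; p']) ->
  all inner (r' :: rcons X p ++ [:: r; p']) ->
  pairing g [:: (p, r)] (arcs (r' :: rcons X p))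
    - pairing g [:: (p', r')] (arcs (r' :: rcons X p))
  = pairing g [:: (p, r)] (arcs (r' :: rcons X' p))
    - pairing g [:: (p', r')] (arcs (r' :: rcons X' p)).
Proof.
move=> XX' uX iX; have [M pM] := complete_path uX iX.
apply: (rotation_identity gC gl XX' (Y := M)).
apply: perm_trans pM; rewrite /= perm_cons -catA perm_cat2l /= perm_cons.
by rewrite -cats1 (perm_catC M [:: p']).
Qed.

Ltac expand_pairing := rewrite /pairing /arcs /= !big_cons !big_nil /= ?addr0.

Lemma swap_identity (p r p' r' a b c d : nat) :
  uniq [:: p; r; p'; r'; a; b; c; d] -> all inner [:: p; r; p'; r'; a; b; c; d] ->
  g p r a b + g p r b c + g p r c d - g p r a c - g p r c b - g p r b d
  = g p' r' a b + g p' r' b c + g p' r' c d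
    - g p' r' a c - g p' r' c b - g p' r' b d.
Proof.
move=> u i; split_uniq.
have XX' : perm_eq [:: a; b; c; d] [:: a; c; b; d].
  by rewrite /= perm_cons (perm_cat2r [:: d] [:: b; c] [:: c; b]) (perm_catC [:: b] [:: c]).
have := @rotation_identity_inner p r p' r' _ _ XX'.
expand_pairing; move=> H.
have {}H := H ltac:(distinct) ltac:(distinct).
lra.
Qed.

(** The exchanged vertices stand next to [p]. This brings in adjacent arcs such as [(c, p)] and
    [(p, r)]; the next lemma is the counterpart at [r']. *)
Lemma swap_identity_last (p r p' r' a b c : nat) :
  uniq [:: p; r; p'; r'; a; b; c] -> all inner [:: p; r; p'; r'; a; b; c] ->
  g p r a b + g p r b c + g p r c p - g p r a c - g p r c b - g p r b p
  = g p' r' a b + g p' r' b c + g p' r' c p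
    - g p' r' a c - g p' r' c b - g p' r' b p.
Proof.
move=> u i; split_uniq.
have XX' : perm_eq [:: a; b; c] [:: a; c; b].
  by rewrite /= perm_cons (perm_catC [:: b] [:: c]).
have := @rotation_identity_inner p r p' r' _ _ XX'.
expand_pairing; move=> H.
have {}H := H ltac:(distinct) ltac:(distinct).
lra.
Qed.

Lemma swap_identity_first (p r p' r' b c d : nat) :
  uniq [:: p; r; p'; r'; b; c; d] -> all inner [:: p; r; p'; r'; b; c; d] ->
  g p r r' b + g p r b c + g p r c d - g p r r' c - g p r c b - g p r b d
  = g p' r' r' b + g p' r' b c + g p' r' c d
    - g p' r' r' c - g p' r' c b - g p' r' b d.
Proof.
move=> u i; split_uniq.
have XX' : perm_eq [:: b; c; d] [:: c; b; d].
  by rewrite /= (perm_cat2r [:: d] [:: b; c] [:: c; b]) (perm_catC [:: b] [:: c]).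
have := @rotation_identity_inner p r p' r' _ _ XX'.
expand_pairing; move=> H.
have {}H := H ltac:(distinct) ltac:(distinct).
lra.
Qed.

(** Subtracting [swap_identity] for [a] and for [a'] cancels every term that is free of both. *)
Lemma exchange_disjoint (p r p' r' a a' b c : nat) : (10 < n)%N ->
  uniq [:: p; r; p'; r'; a; a'; b; c] -> all inner [:: p; r; p'; r'; a; a'; b; c] ->
  g p r a b - g p r a c - g p r a' b + g p r a' c
  = g p' r' a b - g p' r' a c - g p' r' a' b + g p' r' a' c.
Proof.
move=> n10 u i.
have [|s [sz us is' /=]] := @fresh_seq n 1 [:: p; r; p'; r'; a; a'; b; c].
  by move: n10; clear; rewrite /=; lia.
case: s sz us is' => [|d [|]] //= _ _ id; rewrite /= !inE !negb_or => nd.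
split_uniq.
have := @swap_identity p r p' r' a b c d ltac:(distinct) ltac:(distinct).
have := @swap_identity p r p' r' a' b c d ltac:(distinct) ltac:(distinct).
lra.
Qed.

(** The arcs [(p, r)] and [(p', r')] may share vertices, so they are compared through a fresh third
    arc. *)
Lemma exchange (p r p' r' a a' b c : nat) : (14 < n)%N ->
  uniq [:: p; r; a; a'; b; c] -> uniq [:: p'; r'; a; a'; b; c] ->
  all inner [:: p; r; p'; r'; a; a'; b; c] ->
  g p r a b - g p r a c - g p r a' b + g p r a' c
  = g p' r' a b - g p' r' a c - g p' r' a' b + g p' r' a' c.
Proof.
move=> n14 u u' i.
have [|s [sz us is' /=]] := @fresh_seq n 2 [:: p; r; p'; r'; a; a'; b; c].
  by move: n14; clear; rewrite /=; lia.
case: s sz us is' => [|d [|e []]] //= _ us id; rewrite /= !inE !negb_or => nd.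
split_uniq.
have n10 : (10 < n)%N by apply: leq_ltn_trans n14.
rewrite (@exchange_disjoint p r d e a a' b c) //; [|by distinct|by distinct].
by rewrite (@exchange_disjoint p' r' d e a a' b c) //; distinct.
Qed.

(* x, y, z, w are base points: each term on the right depends on at most two of
   the indices i, j, k, m. *)
Lemma six_terms (x y z w i j k m : nat) : (14 < n)%N ->
  uniq [:: i; j; k; m; x; y; z; w] -> all inner [:: i; j; k; m; x; y; z; w] ->
  g i j k m = g x y k m + g i j z w + g i y k w + g x j z m + g x j k w + g i y z m
   - 2 * g x y k w - 2 * g x y z m - 2 * g i y z w - 2 * g x j z w + 3 * g x y z w.
Proof.
move=> n14 u inn; split_uniq.
have := @exchange i j x y k z m w n14 ltac:(distinct) ltac:(distinct) ltac:(distinct).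
have := @exchange k w z w i x j y n14 ltac:(distinct) ltac:(distinct) ltac:(distinct).
have := @exchange z m z w i x j y n14 ltac:(distinct) ltac:(distinct) ltac:(distinct).
rewrite !(gC k w) !(gC z w) !(gC z m); lra.
Qed.



(* The terms of [six_terms] in (j, k) and in (i, m) vanish in second differences. *)
Lemma no_mixed_terms (x y z w i i' m m' : nat) : (14 < n)%N ->
  uniq [:: i; i'; m; m'; x; y; z; w] -> all inner [:: i; i'; m; m'; x; y; z; w] ->
  g x i' m w - g x i m w - g x i' m' w + g x i m' w = 0
  /\ g m y z i' - g m y z i - g m' y z i' + g m' y z i = 0.
Proof.
move=> n14 u inn.
have [|s [sz us is' /=]] := @fresh_seq n 2 [:: i; i'; m; m'; x; y; z; w].
  by move: n14; clear; rewrite /=; lia.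
case: s sz us is' => [|j [|k []]] //= _ us id; rewrite /= !inE !negb_or => nd.
split_uniq.
have six a b c d : uniq [:: a; b; c; d; x; y; z; w] ->
    all inner [:: a; b; c; d; x; y; z; w] ->
    g a b c d = g x y c d + g a b z w + g a y c w + g x b z d + g x b c w
      + g a y z d - 2 * g x y c w - 2 * g x y z d - 2 * g a y z w
      - 2 * g x b z w + 3 * g x y z w.
  exact: six_terms.
(* The swaps preserve the set of tails of the two arcs on the left and the set of heads of the two
   arcs on the right. Of the terms of [six], only those in a left head and a right tail survive. *)
have := endswap_identity gC gl (i := i) (i' := i') (j := j) (k := k) (m := m) (m' := m')
  ltac:(distinct) ltac:(distinct).
expand_pairing => H; split.
- move: H.
  rewrite (six i i' k m) ?(six i i' m m') ?(six i' j k m) ?(six i' j m m')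
    ?(six i' i k m) ?(six i' i m m') ?(six i j k m) ?(six i j m m')
    ?(six i i' k m') ?(six i i' m' m) ?(six i' j k m') ?(six i' j m' m)
    ?(six i' i k m') ?(six i' i m' m) ?(six i j k m') ?(six i j m' m);
  by [lra | distinct].
(* With [g] transposed, left and right change roles and the same identity isolates the terms in a
   tail and a head. *)
- move: H; rewrite !(gC i i') !(gC i' j) !(gC i' i) !(gC i j).
  rewrite (six k m i i') ?(six m m' i i') ?(six k m i' j) ?(six m m' i' j)
    ?(six k m i' i) ?(six m m' i' i) ?(six k m i j) ?(six m m' i j)
    ?(six k m' i i') ?(six m' m i i') ?(six k m' i' j) ?(six m' m i' j)
    ?(six k m' i' i) ?(six m' m i' i) ?(six k m' i j) ?(six m' m i j);
  by [lra | distinct].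
Qed.

(** [no_mixed_terms] splits the two mixed terms of [six_terms] by means of the fresh vertices [o]
    and [t]; averaging with the transposed formula makes [A] and [D] symmetric. *)
Lemma disjoint_arcs_structure (Y : seq nat) : (size Y + 20 < n)%N -> all inner Y ->
  exists u A D : nat -> nat -> R,
    [/\ forall i k, A i k = A k i, forall j m, D j m = D m j
      & forall i j k m, {subset [:: i; j; k; m] <= Y} -> uniq [:: i; j; k; m] ->
          g i j k m = u i j + u k m + A i k + D j m].
Proof.
move=> szY iY.
have n14 : (14 < n)%N by apply: leq_trans szY; lia.
have [|s [sz us is' nd]] := @fresh_seq n 6 Y; first by lia.
move/allP: nd => nd; case: s sz us is' nd => [|x [|y [|z [|w [|o [|t []]]]]]] //= _ us inn nd.
have ndP v : v \in [:: x; y; z; w; o; t] -> v \notin Y by move/nd.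
pose u1 i j := g i j z w - 2 * g i y z w - 2 * g x j z w + 3 * g x y z w
  + g x j t w + g i y z t.
pose v1 k m := g x y k m - 2 * g x y k w - 2 * g x y z m + g x o k w + g o y z m
  - g x o t w - g o y z t.
exists (fun i j => (u1 i j + v1 i j) / 2), (fun i k => (g i y k w + g k y i w) / 2),
  (fun j m => (g x j z m + g x m z j) / 2).
split=> [i k|j m|i j k m sY uY]; [by rewrite addrC | by rewrite addrC |].
have E a b c d : {subset [:: a; b; c; d] <= Y} -> uniq [:: a; b; c; d] ->
    g a b c d = u1 a b + v1 c d + g a y c w + g x b z d.
  move=> sub uq.
  have out v : v \in [:: a; b; c; d] ->
      [&& inner v, v != x, v != y, v != z, v != w, v != o & v != t].
    move=> /sub vY; rewrite (allP iY _ vY) /=.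
    by do !(apply/andP; split); apply: contraTneq vY => ->; apply: ndP;
      rewrite !inE eqxx ?orbT.
  have oa := out a ltac:(by rewrite !inE eqxx ?orbT).
  have ob := out b ltac:(by rewrite !inE eqxx ?orbT).
  have oc := out c ltac:(by rewrite !inE eqxx ?orbT).
  have od := out d ltac:(by rewrite !inE eqxx ?orbT).
  split_uniq.
  rewrite (@six_terms x y z w a b c d n14 ltac:(distinct) ltac:(distinct)) /u1 /v1.
  have [+ _] := @no_mixed_terms x y z w o b c t n14 ltac:(distinct) ltac:(distinct).
  have [_ +] := @no_mixed_terms x y z w o d a t n14 ltac:(distinct) ltac:(distinct).
  have [+ _] := @no_mixed_terms x y z w o d a t n14 ltac:(distinct) ltac:(distinct).
  have [_ +] := @no_mixed_terms x y z w t d a o n14 ltac:(distinct) ltac:(distinct).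
  lra.
have := E i j k m sY uY.
have := E k m i j; rewrite (gC k m i j) => -> //; first by lra.
  by move=> v; rewrite !inE => vv; apply: sY; rewrite !inE;
    case/or4P: vv => ->; rewrite ?orbT.
split_uniq; by distinct.
Qed.

(** For two arcs through [j], [swap_identity_last] replaces the outer vertex [i] by [g1] and
    [swap_identity_first] replaces [m] by [g2], both at the price of disjoint pairs only. What is
    left over on the path [g1], [j], [g2] defines [b j]. *)
Lemma local_structure (Y : seq nat) : (size Y + 30 < n)%N -> all inner Y ->
  exists (u A D : nat -> nat -> R) (b : nat -> R),
    [/\ forall i k, A i k = A k i, forall j m, D j m = D m j,
        forall i j k m, {subset [:: i; j; k; m] <= Y} -> uniq [:: i; j; k; m] ->
          g i j k m = u i j + u k m + A i k + D j m
      & forall i j m, {subset [:: i; j; m] <= Y} -> uniq [:: i; j; m] ->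
          g i j j m = u i j + u j m + A i j + D j m + b j].
Proof.
move=> szY iY.
have [|s [sz us is' nd]] := @fresh_seq n 6 Y; first by lia.
move/allP: nd => nd; case: s sz us is' nd => [|g1 [|g2 [|a [|c [|p [|q []]]]]]] //= _ us inn nd.
have ndP v : v \in [:: g1; g2; a; c; p; q] -> v \notin Y by move/nd.
have [||u [A [D [AC DC E]]]] := @disjoint_arcs_structure ([:: g1; g2; a; c; p; q] ++ Y).
- by rewrite size_cat /= -addSn addnC; move: szY; clear; lia.
- by rewrite all_cat iY andbT.
exists u, A, D, (fun j => g g1 j j g2 - u g1 j - u j g2 - A g1 j - D j g2).
split=> // [i j k m sY uY|i j m sY uY].
  by apply: E => // v /sY vY; rewrite mem_cat vY orbT.
have out v : v \in [:: i; j; m] ->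
    [&& v \in Y, inner v, v != g1, v != g2, v != a, v != c, v != p & v != q].
  move=> /sY vY; rewrite vY (allP iY _ vY) /=.
  by do !(apply/andP; split); apply: contraTneq vY => ->; apply: ndP;
    rewrite !inE eqxx ?orbT.
have oi := out i ltac:(by rewrite !inE eqxx ?orbT).
have oj := out j ltac:(by rewrite !inE eqxx ?orbT).
have om := out m ltac:(by rewrite !inE eqxx ?orbT).
split_uniq.
pose W := [:: g1; g2; a; c; p; q] ++ Y.
have WY v : v \in Y -> v \in W by move=> vY; rewrite mem_cat vY orbT.
have WG : all (mem W) [:: g1; g2; a; c; p; q; i; j; m].
  apply/allP => v; rewrite (mem_cat v [:: g1; g2; a; c; p; q] [:: i; j; m]).
  by case/orP=> [vg|/sY/WY//]; rewrite /= mem_cat vg.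
have {}E b1 b2 b3 b4 : all (mem W) [:: b1; b2; b3; b4] ->
    uniq [:: b1; b2; b3; b4] -> g b1 b2 b3 b4 = u b1 b2 + u b3 b4 + A b1 b3 + D b2 b4.
  by move=> /allP sub; apply: E.
split_uniq; clear nd ndP out sY iY szY.
have H1 := @swap_identity_last j m p q a i g1 ltac:(distinct) ltac:(distinct).
have H2 := @swap_identity_first p q g1 j m g2 c ltac:(distinct) ltac:(distinct).
move: H1 H2; rewrite !(gC j m).
move: (g g1 j j m) (g i j j m) (g g1 j j g2) => h1 h2 h3.
rewrite !E; by [lra | distinct].
Qed.

End LocalStructure.

(** * Elimination of a vertex *)

Definition closed_arcs (s : seq nat) := arcs (rcons s (head 0%N s)).

Lemma closed_arcsE (s : seq nat) : uniq s ->
  closed_arcs s = [seq (x, next s x) | x <- s].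
Proof.
case: s => [|h p] // us.
have trunc x y (q : seq nat) : zip (x :: rcons q y) (rcons q y) = zip (x :: q) (rcons q y).
  by elim: q x => [|z q IHq] x //=; rewrite -IHq.
rewrite /closed_arcs /arcs [head _ _]/= [behead _]/= rcons_cons trunc.
apply: (@eq_from_nth _ (0%N, 0%N)).
  by rewrite size_zip size_map size_rcons minnn.
move=> i; rewrite size_zip size_rcons minnn => ip.
rewrite nth_zip ?size_rcons // (nth_map 0%N) // next_nth mem_nth // index_uniq //.
congr (_, _); rewrite nth_rcons; case: ltngtP => // [ilt|igt|->].
- exact: set_nth_default.
- by move: ip igt; rewrite ltnS leqNgt => /negbTE ->.
- by rewrite nth_default.
Qed.

Lemma mem_arcs (s : seq nat) e : e \in arcs s -> (e.1 \in s) && (e.2 \in s).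
Proof.
case: e => x y; elim: s => [|a [|b s] IHs] //=.
rewrite inE => /orP[/eqP[-> ->]|/IHs /= /andP[xs ys]].
  by rewrite !inE !eqxx !orbT.
by rewrite inE xs orbT inE ys orbT.
Qed.

Lemma next_next_neq (T : eqType) (s : seq T) x : uniq s -> (2 < size s)%N -> x \in s ->
  (next s x != x) && (next s (next s x) != x).
Proof.
move=> us szs xs; have [i p rs] := rot_to xs.
rewrite -(next_rot i us) -(next_rot i us) rs.
have := us; rewrite -(rot_uniq i) rs; move: szs; rewrite -(size_rot i) rs.
case: p {rs} => [|y [|z p]] //= _; rewrite !inE !negb_or eqxx.
case/andP=> /and3P[xy xz _] /andP[/andP[yz _] _].
have yx : y == x = false by rewrite eq_sym (negbTE xy).
by rewrite yx eqxx /= eq_sym xz.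
Qed.

(** * Costs that split over tails and heads *)

Section LinearPart.

Variables (R : realType) (n : nat).
Variables (Q : nat -> nat -> nat -> nat -> R).

Definition sym_cost i j k m := Q i j k m + Q k m i j.

Lemma sym_costC i j k m : sym_cost i j k m = sym_cost k m i j.
Proof. exact: addrC. Qed.

Definition compatible (i j k m : nat) : bool :=
  [&& i != j, k != m, i != k, j != m & ~~ ((i == m) && (j == k))].

(* Summing a(i,j,k) over the tails k, and b(i,j,m) over the heads m, of the other
   arcs of a tour gives a number that does not depend on the tour. *)
Definition splits (a b : nat -> nat -> nat -> R) i j k m :=
  a i j k + b i j m + a k m i + b k m j.

Definition split_coef (a b : nat -> nat -> nat -> R) i j :=
  Q i j i j + \sum_(k <- iota 0 n | k != i) a i j k
            + \sum_(m <- iota 0 n | m != j) b i j m.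

Variable (s : seq nat).
Hypothesis (ts : perm_eq s (iota 0 n)).

Let us : uniq s. Proof. by rewrite (perm_uniq ts) iota_uniq. Qed.

Lemma closed_arcs_compatible e f : (2 < n)%N ->
  e \in closed_arcs s -> f \in closed_arcs s -> e != f ->
  [&& e.1 < n, e.2 < n, f.1 < n, f.2 < n & compatible e.1 e.2 f.1 f.2]%N.
Proof.
move=> n2; rewrite closed_arcsE //.
have szs : (2 < size s)%N by rewrite (perm_size ts) size_iota.
have lt x : x \in s -> (x < n)%N by rewrite (perm_mem ts) mem_iota.
case/mapP=> x xs -> /mapP[y ys ->] xy /=.
have {}xy : x != y by apply: contraNneq xy => ->.
have nx : next s x \in s by rewrite mem_next.
have ny : next s y \in s by rewrite mem_next.
have /andP[n1 n3] := next_next_neq us szs xs.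
have /andP[n4 _] := next_next_neq us szs ys.
rewrite !lt // /compatible eq_sym n1 eq_sym n4 xy /=.
rewrite (can_eq (prev_next us)) xy /=.
by apply/negP=> /andP[/eqP xny /eqP nxy]; move: n3; rewrite nxy -xny eqxx.
Qed.

(** The error of the splitting is kept as an explicit term, so that one identity serves both
    directions: a vanishing error gives a linearization, and for suitable [a], [b] the error is the
    reduced cost. *)
Lemma closed_arcs_split (a b : nat -> nat -> nat -> R) :
  2 * pairing Q (closed_arcs s) (closed_arcs s)
  = 2 * \sum_(e <- closed_arcs s) split_coef a b e.1 e.2
    + \sum_(e <- closed_arcs s) \sum_(f <- closed_arcs s | f != e)
        (sym_cost e.1 e.2 f.1 f.2 - splits a b e.1 e.2 f.1 f.2).
Proof.
set c := closed_arcs s.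
have cE : c = [seq (x, next s x) | x <- s] by rewrite /c closed_arcsE.
have uc : uniq c.
  by rewrite cE map_inj_in_uniq // => x y _ _ [].
have sumsym (F : nat * nat -> nat * nat -> R) :
    \sum_(e <- c) \sum_(f <- c | f != e) F f e = \sum_(e <- c) \sum_(f <- c | f != e) F e f.
  under eq_bigr do rewrite big_mkcond.
  rewrite exchange_big; apply: eq_bigr => e _; rewrite [RHS]big_mkcond.
  by apply: eq_bigr => f _; rewrite eq_sym.
have -> : 2 * pairing Q c c = \sum_(e <- c) 2 * Q e.1 e.2 e.1 e.2
    + \sum_(e <- c) \sum_(f <- c | f != e) sym_cost e.1 e.2 f.1 f.2.
  transitivity (\sum_(e <- c) \sum_(f <- c) sym_cost e.1 e.2 f.1 f.2).
    have -> : 2 * pairing Q c c = pairing Q c c + pairing Q c c by ring.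
    rewrite {2}/pairing exchange_big -big_split; apply: eq_bigr => e _ /=.
    by rewrite -big_split.
  rewrite -big_split; apply: eq_big_seq => e ec /=.
  rewrite (bigD1_seq e) //=; congr (_ + _); rewrite /sym_cost; ring.
under [X in _ = _ + X]eq_bigr do rewrite sumrB.
rewrite sumrB.
suff -> : \sum_(e <- c) 2 * Q e.1 e.2 e.1 e.2 = 2 * (\sum_(e <- c) split_coef a b e.1 e.2)
  - \sum_(e <- c) \sum_(f <- c | f != e) splits a b e.1 e.2 f.1 f.2 by ring.
(* Exchanging [e] and [f] shows that the two halves of [splits] have equal sums. *)
have -> : \sum_(e <- c) \sum_(f <- c | f != e) splits a b e.1 e.2 f.1 f.2
    = 2 * \sum_(e <- c) \sum_(f <- c | f != e) (a e.1 e.2 f.1 + b e.1 e.2 f.2).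
  have -> : \sum_(e <- c) \sum_(f <- c | f != e) splits a b e.1 e.2 f.1 f.2
    = \sum_(e <- c) \sum_(f <- c | f != e) (a e.1 e.2 f.1 + b e.1 e.2 f.2)
    + \sum_(e <- c) \sum_(f <- c | f != e) (a f.1 f.2 e.1 + b f.1 f.2 e.2).
    rewrite -big_split; apply: eq_bigr => e _; rewrite -big_split.
    by apply: eq_bigr => f _; rewrite /= /splits addrA.
  by rewrite (sumsym (fun e f => a e.1 e.2 f.1 + b e.1 e.2 f.2)); ring.
rewrite -mulr_sumr -mulrBr; congr (_ * _).
rewrite -sumrB; apply: eq_big_seq => e; rewrite {1}cE => /mapP[y ys ->] /=.
rewrite big_split /= /split_coef.
have -> : \sum_(f <- c | f != (y, next s y)) a y (next s y) f.1
    = \sum_(k <- iota 0 n | k != y) a y (next s y) k.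
  rewrite cE big_map /= -(perm_big _ ts) /=; apply: eq_bigl => x.
  by rewrite xpair_eqE; case: eqP => [->|]; rewrite ?eqxx.
have -> : \sum_(f <- c | f != (y, next s y)) b y (next s y) f.2
    = \sum_(m <- iota 0 n | m != next s y) b y (next s y) m.
  have pn : perm_eq (map (next s) s) (iota 0 n).
    apply: perm_trans ts; apply: uniq_perm => //.
      by rewrite map_inj_in_uniq // => ? ? _ _; apply: (can_inj (prev_next us)).
    move=> x; apply/mapP/idP => [[z zs ->]|xs]; first by rewrite mem_next.
    by exists (prev s x); rewrite ?mem_prev // next_prev.
  rewrite cE big_map /= -(perm_big _ pn) /= big_map; apply: eq_bigl => x.
  by rewrite xpair_eqE (can_eq (prev_next us)) andbb.
ring.
Qed.

Lemma split_sound (a b : nat -> nat -> nat -> R) : (2 < n)%N ->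
  (forall i j k m, [&& i < n, j < n, k < n & m < n]%N -> compatible i j k m ->
     sym_cost i j k m = splits a b i j k m) ->
  pairing Q (closed_arcs s) (closed_arcs s)
  = \sum_(e <- closed_arcs s) split_coef a b e.1 e.2.
Proof.
move=> n2 ok; have := closed_arcs_split a b.
have -> : \sum_(e <- closed_arcs s) \sum_(f <- closed_arcs s | f != e)
    (sym_cost e.1 e.2 f.1 f.2 - splits a b e.1 e.2 f.1 f.2) = 0.
  rewrite big_seq big1 // => e ec; rewrite big_seq_cond big1 // => f /andP[fc fe].
  have := closed_arcs_compatible n2 ec fc; rewrite eq_sym fe => /(_ isT).
  by case/and5P=> e1 e2 f1 f2 ef; rewrite ok ?subrr //; apply/and4P.
by lra.
Qed.

End LinearPart.

(** * Reduction to pairs of arcs avoiding vertex 0 *)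

Section Reduction.

Variables (R : realType) (n : nat).
Variables (Q : nat -> nat -> nat -> nat -> R).
Local Notation sq := (sym_cost Q).

(* On tours, x(k,0) = 1 - sum_m x(k,m) and x(0,m) = 1 - sum_k x(k,m): eliminating
   the arcs at vertex 0 leaves these costs of pairs of arcs avoiding 0. *)
Definition reduced_cost i j k m :=
  sq i j k m - sq i j 0 m - sq i j k 0 - sq k m 0 j - sq k m i 0
  + sq 0 m i 0 + sq 0 j k 0.

Lemma reduced_costC i j k m : reduced_cost i j k m = reduced_cost k m i j.
Proof. rewrite /reduced_cost (sym_costC Q i j k m); ring. Qed.

Variables (u A D : nat -> nat -> R) (t : nat -> R).

(** On nonzero indices, [tail_split] and [head_split] distribute the terms obtained by solving
    [reduced_cost] for [sq i j k m]. The values at an index 0 are chosen so that [u], [A], [D], [t]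
    cancel on every compatible pair touching 0. Indicators replace case distinctions, so that a real
    expression of the machine can follow the formula. *)
Definition tail_split i j k :=
  (1 - (k == 0%N)%:R) * ((j == 0%N)%:R * - A k i + (1 - (j == 0%N)%:R) *
    (sq i j k 0 + (1 - (i == 0%N)%:R) * (A i k + u i j + (j == k)%:R * t j))).

Definition head_split i j m :=
  (m == 0%N)%:R * (1 - (i == 0%N)%:R) * - u i j
  + (1 - (m == 0%N)%:R) * ((i == 0%N)%:R * - D m j + (1 - (i == 0%N)%:R) *
     ((j == 0%N)%:R * - ((i == m)%:R * t m)
      + (1 - (j == 0%N)%:R) * (sq i j 0 m - sq 0 m i 0 + D j m))).

(** Applied with zero coefficients, where the residue is the reduced cost, and with the candidate,
    where it is the defect in the structural equation. *)
Lemma split_residue i j k m : compatible i j k m ->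
  sq i j k m - splits tail_split head_split i j k m
  = if [&& i != 0, j != 0, k != 0 & m != 0]%N then
      reduced_cost i j k m - u i j - u k m - A i k - A k i - D j m - D m j
      - (j == k)%:R * t j - (i == m)%:R * t m
    else 0.
Proof.
case/and5P=> ij km ik jm; rewrite negb_and => rev.
rewrite /splits /tail_split /head_split /reduced_cost.
rewrite (eq_sym m i) (eq_sym k j).
case: (eqVneq i 0%N) ij ik rev => [->|i0] ij ik rev;
  case: (eqVneq k 0%N) km ik rev => [->|k0] km ik rev //;
  case: (eqVneq j 0%N) ij jm rev => [->|j0] ij jm rev //;
  case: (eqVneq m 0%N) km jm rev => [->|m0] km jm rev //;
  rewrite ?eqxx ?(negbTE i0) ?(negbTE j0) ?(negbTE k0) ?(negbTE m0) /=;
  rewrite ?(sym_costC Q 0 j) ?(sym_costC Q i 0 0 m) ?(sym_costC Q i 0 k m);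
  try (move: rev => /=; rewrite ?orbF => /negbTE ->); rewrite ?mulr0n;
  move: ((j == k)%:R : R) ((i == m)%:R : R) ((0%N == k)%:R : R) => c1 c2 c3; ring.
Qed.

End Reduction.

Lemma filter_inner_arcs (p : seq nat) : 0%N \notin p ->
  [seq e <- arcs (0%N :: rcons p 0%N) | (e.1 != 0%N) && (e.2 != 0%N)] = arcs p.
Proof.
case/lastP: p => [|p t] // p0.
have -> : arcs (0%N :: rcons (rcons p t) 0%N)
    = (0%N, head 0%N (rcons p t)) :: rcons (arcs (rcons p t)) (t, 0%N).
  by case: p p0 => [|h p] _ //; rewrite -arcs_rcons2.
rewrite /= filter_rcons andbF; apply/all_filterP/allP => e /mem_arcs.
by case/andP=> e1 e2; apply/andP; split; apply: contraNneq p0 => <-.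
Qed.

(** * From linear tour costs to linear path costs *)

Section Completeness.

Variables (R : realType) (n : nat).
Variables (Q : nat -> nat -> nat -> nat -> R) (C : nat * nat -> R).
Hypothesis linQ : forall s, perm_eq s (iota 0 n) ->
  pairing Q (closed_arcs s) (closed_arcs s) = \sum_(e <- closed_arcs s) C e.

Local Notation red := (reduced_cost Q).

Lemma reduced_cost_linear : (2 < n)%N ->
  exists l, forall p, perm_eq p (iota 1 n.-1) ->
    pairing red (arcs p) (arcs p) = \sum_(e <- arcs (0%N :: rcons p 0%N)) l e.
Proof.
move=> n2.
pose z2 := fun _ _ : nat => 0 : R; pose z1 := fun _ : nat => 0 : R.
pose a := tail_split Q z2 z2 z1; pose b := head_split Q z2 z2 z1.
pose nz (e : nat * nat) := (e.1 != 0%N) && (e.2 != 0%N).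
(* The factors 2 come from the symmetrization. The last summand restores the diagonal pairs, which
   [pairing] counts and the error term of [closed_arcs_split] omits. *)
exists (fun e => 2 * C e - 2 * split_coef n Q a b e.1 e.2
  + (if nz e then red e.1 e.2 e.1 e.2 else 0)) => p pp.
have ts : perm_eq (0%N :: p) (iota 0 n).
  by rewrite -(prednK (ltnW (ltnW n2))) /= perm_cons.
have us : uniq (0%N :: p) by rewrite (perm_uniq ts) iota_uniq.
have cE : closed_arcs (0%N :: p) = arcs (0%N :: rcons p 0%N) by [].
have := closed_arcs_split Q ts a b; rewrite (linQ ts) cE.
have p0 : 0%N \notin p by case/andP: us.
have -> : \sum_(e <- arcs (0%N :: rcons p 0%N))
    \sum_(f <- arcs (0%N :: rcons p 0%N) | f != e)
      (sym_cost Q e.1 e.2 f.1 f.2 - splits a b e.1 e.2 f.1 f.2)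
  = pairing red (arcs p) (arcs p) - \sum_(e <- arcs p) red e.1 e.2 e.1 e.2.
  have uc : uniq (arcs p).
    by rewrite -filter_inner_arcs // filter_uniq // -cE closed_arcsE // map_inj_in_uniq // => x y _ _ [].
  transitivity (\sum_(e <- arcs p) \sum_(f <- arcs p | f != e) red e.1 e.2 f.1 f.2).
    rewrite -[X in _ = \sum_(e <- X) _](filter_inner_arcs p0) big_filter [RHS]big_mkcond.
    apply: eq_big_seq => e; rewrite -cE => ec.
    rewrite -{1}(filter_inner_arcs p0) big_filter_cond -cE /=.
    have res f : f \in closed_arcs (0%N :: p) -> f != e ->
        sym_cost Q e.1 e.2 f.1 f.2 - splits a b e.1 e.2 f.1 f.2
        = if nz e && nz f then red e.1 e.2 f.1 f.2 else 0.
      move=> fc fe; have := closed_arcs_compatible ts n2 ec fc.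
      rewrite eq_sym fe => /(_ isT) /and5P[_ _ _ _ comp].
      rewrite split_residue // /nz /z1 /z2 -andbA; case: ifP => _ //; ring.
    case: ifP => nze; last first.
      by rewrite big_seq_cond big1 // => f /andP[fc fe]; rewrite res // /nz nze.
    rewrite [LHS]big_seq_cond [RHS]big_seq_cond.
    rewrite [RHS](eq_bigl (fun f => (f \in closed_arcs (0%N :: p)) && (f != e) && nz f)).
      rewrite [RHS]big_mkcondr; apply: eq_bigr => f /andP[fc fe].
      by rewrite res // /nz nze.
    by move=> f; rewrite -/(nz f) (andbC (nz f)) andbA.
  rewrite /pairing -sumrB; apply: eq_big_seq => e ec.
  by rewrite [in RHS](bigD1_seq e) //= addrAC subrr add0r.
move=> H; rewrite !big_split /= sumrN -!mulr_sumr -big_mkcond.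
have -> : \sum_(e <- arcs (0%N :: rcons p 0%N) | nz e) red e.1 e.2 e.1 e.2
    = \sum_(e <- arcs p) red e.1 e.2 e.1 e.2.
  by rewrite -[in RHS](filter_inner_arcs p0) big_filter.
move: H; lra.
Qed.

End Completeness.

(** * Recovering the coefficients from a few entries *)

Section Candidate.

Variables (R : realType) (g : nat -> nat -> nat -> nat -> R).

(** Exchanging the heads keeps the tails and, [D] being symmetric, the head term as well; only
    values of [u] remain. *)
Definition head_swap i j k m := g i j k m - g i m k j.

(** Reference vertices off the given indices. Within each candidate formula the ranges of the picks
    are disjoint from one another and from the fixed vertices beside them. *)
Definition pick2 (c i : nat) := if i == c then c.+1 else c.
Definition pick3 (c i k : nat) :=
  if (i == c) || (k == c) then (if (i == c.+1) || (k == c.+1) then c.+2 else c.+1)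
  else c.

Lemma pick2P c i : pick2 c i != i /\ (c <= pick2 c i <= c.+1)%N.
Proof. by rewrite /pick2; case: (eqVneq i c) => ?; split; lia. Qed.

Lemma pick3P c i k :
  [/\ pick3 c i k != i, pick3 c i k != k & (c <= pick3 c i k <= c.+2)%N].
Proof. by rewrite /pick3; case: ifP => ?; [case: ifP => ?|]; split; lia. Qed.

(* The gauge of u in u(i,j) + u(k,m) - u(i,m) - u(k,j) = head_swap i j k m is
   fixed by letting u vanish at (1,j), at (i, pick2 2 i) and at (2,1). *)
Definition cand_w i j := head_swap i j 1 (pick2 2 i).

Definition cand_u i j :=
  (1 - (j == 1%N)%:R) * cand_w i j
  + (j == 1%N)%:R * (head_swap i 1 2 (pick2 3 i) + cand_w i (pick2 3 i)
                     - cand_w 2 (pick2 3 i)).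

Definition cand_y i j k m := g i j k m - cand_u i j - cand_u k m.

(** A constant can be shifted between [A] and [D]; it is fixed by making [cand_A 1 2] vanish. The
    structural equation contains both [A i k] and [A k i], hence the halves. *)
Definition cand_A i k :=
  (cand_y i (pick3 3 i k) k (pick3 6 i k)
   - cand_y 1 (pick3 3 i k) 2 (pick3 6 i k)) / 2.

Definition cand_D j m :=
  cand_y (pick3 3 j m) j (pick3 6 j m) m / 2 - cand_A (pick3 3 j m) (pick3 6 j m).

Definition cand_t j :=
  cand_y (pick2 3 j) j j (pick2 5 j)
  - cand_A (pick2 3 j) j - cand_A j (pick2 3 j)
  - cand_D j (pick2 5 j) - cand_D (pick2 5 j) j.

Variables (l : nat * nat -> R) (n : nat).
Hypothesis gC : forall i j k m, g i j k m = g k m i j.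
Hypothesis gl : forall p, perm_eq p (iota 1 n.-1) ->
  pairing g (arcs p) (arcs p) = \sum_(e <- arcs (0%N :: rcons p 0%N)) l e.

Lemma candidate_complete (i j k m : nat) : (50 < n)%N ->
  all (inner n) [:: i; j; k; m] -> compatible i j k m ->
  g i j k m = cand_u i j + cand_u k m + cand_A i k + cand_A k i + cand_D j m
    + cand_D m j + (j == k)%:R * cand_t j + (i == m)%:R * cand_t m.
Proof.
move=> n50 inn comp.
(* The vertices 1, ..., 8 include every base point and every pick of the candidate formulas. *)
pose Y := iota 1 8 ++ [:: i; j; k; m].
have iY : all (inner n) Y.
  rewrite all_cat inn andbT; apply/allP => v; rewrite mem_iota /inner; lia.
have [|u [A [D [b [AC DC E E']]]]] := local_structure gC gl (Y := Y) _ iY.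
  by rewrite size_cat size_iota /=; lia.
have Yc v : (0 < v < 9)%N -> v \in Y by rewrite mem_cat mem_iota => ->.
have [iY0 jY kY mY] : [/\ i \in Y, j \in Y, k \in Y & m \in Y].
  by split; rewrite mem_cat !inE eqxx ?orbT.
clearbody Y; clear inn iY.
have {}E v1 v2 v3 v4 : v1 \in Y -> v2 \in Y -> v3 \in Y -> v4 \in Y ->
    uniq [:: v1; v2; v3; v4] -> g v1 v2 v3 v4 = u v1 v2 + u v3 v4 + A v1 v3 + D v2 v4.
  by move=> ? ? ? ? ?; apply: E => // v; rewrite !inE => /or4P[] /eqP ->.
have {}E' v1 v2 v3 : v1 \in Y -> v2 \in Y -> v3 \in Y -> uniq [:: v1; v2; v3] ->
    g v1 v2 v2 v3 = u v1 v2 + u v2 v3 + A v1 v2 + D v2 v3 + b v2.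
  by move=> ? ? ? ?; apply: E' => // v; rewrite !inE => /or3P[] /eqP ->.
have swapE v1 v2 v3 v4 : v1 \in Y -> v2 \in Y -> v3 \in Y -> v4 \in Y ->
    v1 != v2 -> v3 != v4 -> v1 != v4 -> v3 != v2 ->
    head_swap v1 v2 v3 v4 = u v1 v2 + u v3 v4 - u v1 v4 - u v3 v2.
  rewrite /head_swap => y1 y2 y3 y4 d12 d34 d14 d32.
  (* With equal heads or equal tails both sides vanish, so a base point may coincide with an
     index. *)
  case: (eqVneq v2 v4) => [->|d24]; first by rewrite subrr; ring.
  case: (eqVneq v1 v3) => [->|d13]; first by rewrite gC subrr; ring.
  rewrite (E v1 v2) ?(E v1 v4) ?(DC v4) //; by [ring | distinct].
have Y1 : (1 \in Y)%N by apply: Yc.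
have Y2 : (2 \in Y)%N by apply: Yc.
(* [s] and [t] describe the change of gauge from the local [u] to [cand_u]; [A'] and [D'] below
   compensate it. *)
pose w0 v := u v (pick2 2 v) - u 1%N (pick2 2 v).
pose s v := if v == 1%N then 0 else - w0 v.
pose t v := if v == 1%N then - (u 2%N 1%N + s 2%N) else - u 1%N v.
have wE x y : x \in Y -> y \in Y -> x != y -> y != 1%N -> cand_w x y = u x y + s x + t y.
  move=> xY yY dxy y1; have [px pr] := pick2P 2 x.
  rewrite /cand_w swapE //; last 1 first.
  - by rewrite eq_sym.
  - rewrite /s /t /w0 (negbTE y1); case: (eqVneq x 1%N) => [->|x1]; ring.
  - by apply: Yc; lia.
  - by clear -pr; lia.
  - by rewrite eq_sym.
have uE x y : x \in Y -> y \in Y -> x != y -> cand_u x y = u x y + s x + t y.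
  move=> xY yY dxy; rewrite /cand_u; case: (eqVneq y 1%N) dxy => [->|y1] dxy.
    have [px pr] := pick2P 3 x; have pY : pick2 3 x \in Y by apply: Yc; lia.
    have [p1 p2] : pick2 3 x != 1%N /\ 2%N != pick2 3 x by clear -pr; lia.
    rewrite (_ : true%:R = 1) // subrr mul0r add0r mul1r.
    rewrite swapE ?wE //; try by rewrite eq_sym.
    rewrite [t 1%N]/t eqxx; ring.
  rewrite (_ : false%:R = 0) // wE //; ring.
pose A' x y := A x y - s x - s y; pose D' x y := D x y - t x - t y.
have yE v1 v2 v3 v4 : v1 \in Y -> v2 \in Y -> v3 \in Y -> v4 \in Y ->
    uniq [:: v1; v2; v3; v4] -> cand_y v1 v2 v3 v4 = A' v1 v3 + D' v2 v4.
  move=> y1 y2 y3 y4 uv; rewrite /cand_y E // !uE //; try by split_uniq; distinct.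
  rewrite /A' /D'; ring.
have yE' v1 v2 v3 : v1 \in Y -> v2 \in Y -> v3 \in Y ->
    uniq [:: v1; v2; v3] -> cand_y v1 v2 v2 v3 = A' v1 v2 + D' v2 v3 + b v2.
  move=> y1 y2 y3 uv; rewrite /cand_y E' // !uE //; try by split_uniq; distinct.
  rewrite /A' /D'; ring.
have AE x y : x \in Y -> y \in Y -> x != y -> cand_A x y = (A' x y - A' 1%N 2%N) / 2.
  move=> xY yY dxy; rewrite /cand_A.
  have [p1 p2 pr] := pick3P 3 x y; have [q1 q2 qr] := pick3P 6 x y.
  move: (pick3 3 x y) (pick3 6 x y) p1 p2 pr q1 q2 qr => p q p1 p2 pr q1 q2 qr.
  have pY : p \in Y by apply: Yc; clear -pr; lia.
  have qY : q \in Y by apply: Yc; clear -qr; lia.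
  rewrite !yE //; first ring.
    by rewrite /= !inE; clear -pr qr; lia.
  have pq : p != q by clear -pr qr; lia.
  by clear -p1 p2 q1 q2 pq dxy; distinct.
have DE x y : x \in Y -> y \in Y -> x != y -> cand_D x y = (D' x y + A' 1%N 2%N) / 2.
  move=> xY yY dxy; rewrite /cand_D.
  have [p1 p2 pr] := pick3P 3 x y; have [q1 q2 qr] := pick3P 6 x y.
  move: (pick3 3 x y) (pick3 6 x y) p1 p2 pr q1 q2 qr => p q p1 p2 pr q1 q2 qr.
  have pY : p \in Y by apply: Yc; clear -pr; lia.
  have qY : q \in Y by apply: Yc; clear -qr; lia.
  have pq : p != q by clear -pr qr; lia.
  rewrite yE // ?AE //; first by field.
  by clear -p1 p2 q1 q2 pq dxy; distinct.
have A'C x y : A' x y = A' y x by rewrite /A' AC; ring.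
have D'C x y : D' x y = D' y x by rewrite /D' DC; ring.
have tE x : x \in Y -> cand_t x = b x.
  move=> xY; rewrite /cand_t.
  have [p1 pr] := pick2P 3 x; have [q1 qr] := pick2P 5 x.
  move: (pick2 3 x) (pick2 5 x) p1 pr q1 qr => p q p1 pr q1 qr.
  have pY : p \in Y by apply: Yc; clear -pr; lia.
  have qY : q \in Y by apply: Yc; clear -qr; lia.
  have pq : p != q by clear -pr qr; lia.
  have [p1' q1'] : x != p /\ x != q by rewrite !(eq_sym x).
  rewrite yE' // ?AE // ?DE // ?(A'C x) ?(D'C q); first by field.
  by clear -p1 q1 pq q1'; distinct.
have adjacent x y z : x \in Y -> y \in Y -> z \in Y -> uniq [:: x; y; z] ->
    g x y y z = cand_u x y + cand_u y z + cand_A x y + cand_A y x + cand_D y z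
      + cand_D z y + cand_t y.
  move=> xY yY zY uv; rewrite E' // tE //.
  rewrite !AE // ?DE // ?uE //; try by split_uniq; distinct.
  rewrite (A'C y) (D'C z) /A' /D'; by field.
case/and5P: comp => ij km ik jm; rewrite negb_and => rev.
have [t1 f0] : (true%:R = 1 :> R) /\ (false%:R = 0 :> R) by [].
case: (eqVneq j k) rev => [jk|jk] rev.
  rewrite orbF in rev; subst k; rewrite (negbTE rev) t1 f0 adjacent //; first ring.
  by clear -ij jm rev; distinct.
case: (eqVneq i m) rev => [im _|im _].
  subst m; rewrite gC t1 f0 adjacent //; first ring.
  by clear -ij km ik jm jk; distinct.
rewrite f0 E //; last by clear -ij km ik jm im jk; distinct.
have [ki mj] : k != i /\ m != j by rewrite eq_sym ik eq_sym.
rewrite !AE // !DE // !uE // (A'C k) (D'C m) /A' /D'; by field.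
Qed.

End Candidate.

(** * Tours as cyclic sequences of numbers *)

Section TourSums.

Variables (R : realType) (n : nat).

Lemma tour_sum (s : seq 'I_n) (F : diarc n -> R) (F' : nat * nat -> R) :
  ucycle [rel i j : 'I_n | i != j] s -> size s = n ->
  (forall e, F e = F' (val (arc_tail e), val (arc_head e))) ->
  \sum_(e in [set e | arc_head e == next s (arc_tail e)]) F e
  = \sum_(e <- closed_arcs (map val s)) F' e.
Proof.
move=> /andP[cs us] szs FF'.
have es i : i \in s.
  have [|_ ->] := uniq_min_size us (fun x _ => mem_enum 'I_n x : x \in enum 'I_n).
    by rewrite size_enum_ord szs.
  by rewrite mem_enum.
have nx i : (i, next s i).1 != (i, next s i).2 by exact: (next_cycle cs (es i)).
pose h i : diarc n := exist _ (i, next s i) (nx i).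
have -> : [set e | arc_head e == next s (arc_tail e)] = [set h i | i in 'I_n].
  apply/setP => e; rewrite inE; apply/eqP/imsetP => [e2|[i _ ->]] //.
  by exists (arc_tail e) => //; apply: val_inj; rewrite /= -e2 -surjective_pairing.
rewrite big_imset /=; last by move=> i j _ _ [].
rewrite closed_arcsE ?(map_inj_uniq val_inj) // !big_map.
have ps : perm_eq s (enum 'I_n).
  by apply: uniq_perm; rewrite ?enum_uniq // => x; rewrite es mem_enum.
rewrite (perm_big _ ps) /= big_enum /=; apply: eq_bigr => i _.
by rewrite FF' next_map //; apply: val_inj.
Qed.

Lemma quad_costE (Q : {ffun diarc n * diarc n -> R})
    (q : nat -> nat -> nat -> nat -> R) (s : seq 'I_n) :
  ucycle [rel i j : 'I_n | i != j] s -> size s = n ->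
  (forall e f, Q (e, f) = q (val (arc_tail e)) (val (arc_head e))
                           (val (arc_tail f)) (val (arc_head f))) ->
  quad_cost Q [set e | arc_head e == next s (arc_tail e)]
  = pairing q (closed_arcs (map val s)) (closed_arcs (map val s)).
Proof.
move=> cs szs Qq; rewrite /quad_cost /pairing.
set tau := [set e | _].
transitivity (\sum_(e in tau) \sum_(f in tau) Q (e, f)).
  rewrite pair_big; apply: eq_big => [[e f]|[e f] _] //=; by rewrite inE.
apply: (@tour_sum s _ (fun e => \sum_(f <- closed_arcs (map val s)) q e.1 e.2 f.1 f.2)) => // e.
by apply: (@tour_sum s _ (fun f => q (val (arc_tail e)) (val (arc_head e)) f.1 f.2)).
Qed.

Lemma tour_of_perm (s : seq nat) : (2 < n)%N -> perm_eq s (iota 0 n) ->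
  exists2 s' : seq 'I_n, map val s' = s
    & ucycle [rel i j : 'I_n | i != j] s' /\ size s' = n.
Proof.
move=> n2 ps.
have n0 : (0 < n)%N by apply: ltn_trans n2.
pose s' := [seq insubd (Ordinal n0) i | i <- s].
have sE : map val s' = s.
  rewrite -map_comp -[RHS]map_id; apply/eq_in_map => i.
  by rewrite (perm_mem ps) mem_iota /= => ii; rewrite val_insubd ii.
have us' : uniq s' by rewrite -(map_inj_uniq val_inj) sE (perm_uniq ps) iota_uniq.
have szs' : size s' = n by rewrite size_map (perm_size ps) size_iota.
exists s' => //; split=> //; rewrite /ucycle us' andbT.
apply: cycle_from_next => // x xs /=; rewrite eq_sym.
have s2 : (2 < size s')%N by rewrite szs'.
by have /andP[] := next_next_neq us' s2 xs.
Qed.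

Lemma perm_of_tour (s : seq 'I_n) : uniq s -> size s = n ->
  perm_eq (map val s) (iota 0 n).
Proof.
move=> us szs; have us' : uniq (map val s) by rewrite map_inj_uniq //; apply: val_inj.
have sub : {subset map val s <= iota 0 n}.
  by move=> _ /mapP[i _ ->]; rewrite mem_iota /=.
have [|sz eqs] := uniq_min_size us' sub; first by rewrite size_iota size_map szs.
by apply: uniq_perm => //; rewrite iota_uniq.
Qed.

End TourSums.

(** * Linearizability as a splitting condition *)

Section Criterion.

Variables (R : realType) (n : nat) (Q : {ffun diarc n * diarc n -> R}).
Variable (q : nat -> nat -> nat -> nat -> R).
Hypothesis Qq : forall e f, Q (e, f) = q (val (arc_tail e)) (val (arc_head e))
                                         (val (arc_tail f)) (val (arc_head f)).

Local Notation g := (reduced_cost q).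
Definition cand_tail := tail_split q (cand_u g) (cand_A g) (cand_t g).
Definition cand_head := head_split q (cand_u g) (cand_D g) (cand_t g).

Lemma split_linearization (a b : nat -> nat -> nat -> R) : (2 < n)%N ->
  (forall i j k m, [&& i < n, j < n, k < n & m < n]%N -> compatible i j k m ->
     sym_cost q i j k m = splits a b i j k m) ->
  is_linearization Q (\matrix_(i < n, j < n) split_coef n q a b i j).
Proof.
move=> n2 ok tau [s [cs szs ->]]; rewrite (quad_costE cs szs Qq).
have us : uniq s by case/andP: cs.
rewrite (split_sound (perm_of_tour us szs) n2 ok) /lin_cost; symmetry.
apply: (tour_sum (F' := fun e => split_coef n q a b e.1 e.2)) => // e.
by rewrite mxE.
Qed.

(** Only quadruples of nonzero indices can leave a residue, and there the equation is
    [candidate_complete]. *)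
Lemma linearizable_split : (50 < n)%N -> linearizable Q ->
  forall i j k m, [&& i < n, j < n, k < n & m < n]%N -> compatible i j k m ->
     sym_cost q i j k m = splits cand_tail cand_head i j k m.
Proof.
move=> n50 [C lC] i j k m ijkm comp.
have n2 : (2 < n)%N by apply: ltn_trans n50.
have n0 : (0 < n)%N by apply: ltn_trans n2.
pose c (e : nat * nat) := C (insubd (Ordinal n0) e.1) (insubd (Ordinal n0) e.2).
have lin s : perm_eq s (iota 0 n) ->
    pairing q (closed_arcs s) (closed_arcs s) = \sum_(e <- closed_arcs s) c e.
  move=> /(tour_of_perm n2)[s' <- [cs szs]].
  rewrite -(quad_costE cs szs Qq) lC; last by exists s'.
  by apply: tour_sum => // e; rewrite /c !valKd.
have [l gl] := reduced_cost_linear lin n2.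
apply/eqP; rewrite -subr_eq0 split_residue //; case: ifP => // /and4P[i0 j0 k0 m0].
have inn : all (inner n) [:: i; j; k; m].
  by case/and4P: ijkm => iN jN kN mN; rewrite /inner /= !lt0n i0 j0 k0 m0 iN jN kN mN.
rewrite {1}(candidate_complete (reduced_costC q) gl n50 inn comp).
by apply/eqP; ring.
Qed.

End Criterion.

(** * Instances of a fixed size *)

Definition solves (R : realType) (n : nat) (c : cmd) (K : nat) :=
  forall (Q : {ffun diarc n * diarc n -> R}) (s : store R),
    holds_input Q s ->
    exists (t : nat) (s' : store R),
      [/\ exec c s t s', (t <= K)%N, answers_yes s' <-> linearizable Q
        & linearizable Q -> is_linearization Q (output_matrix n s')].

Section FixedSize.

Variables (R : realType) (n : nat).
Local Notation E := (diarc n).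
Local Notation P := (diarc n * diarc n)%type.

Definition tour_arcs (s : n.-tuple 'I_n) : {set diarc n} :=
  [set e | arc_head e == next s (arc_tail e)].

Definition is_tour_tuple (s : n.-tuple 'I_n) : bool :=
  ucycleb [rel i j : 'I_n | i != j] s.

(** Columns run over all n-tuples; a tuple that is no tour yields a zero column, hence the equation
    0 = 0. *)
Definition arc_incidence (F : fieldType) : 'M[F]_(#|{: E}|, #|{: n.-tuple 'I_n}|) :=
  \matrix_(e, s) (is_tour_tuple (enum_val s) && (enum_val e \in tour_arcs (enum_val s)))%:R.

Definition pair_incidence (F : fieldType) : 'M[F]_(#|{: P}|, #|{: n.-tuple 'I_n}|) :=
  \matrix_(p, s) (is_tour_tuple (enum_val s) &&
    (enum_val p \in setX (tour_arcs (enum_val s)) (tour_arcs (enum_val s))))%:R.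

Definition arc_matrix (c : 'rV[R]_#|{: E}|) : 'M[R]_n :=
  \matrix_(i, j) (if insub (i, j) is Some e then c 0 (enum_rank (e : E)) else 0).

Definition pair_row (Q : {ffun P -> R}) : 'rV[R]_#|{: P}| := \row_p Q (enum_val p).

Lemma linearization_row (Q : {ffun P -> R}) (c : 'rV[R]_#|{: E}|) :
  is_linearization Q (arc_matrix c) <->
  c *m arc_incidence R = pair_row Q *m pair_incidence R.
Proof.
have lhs (s : n.-tuple 'I_n) : is_tour_tuple s ->
    (c *m arc_incidence R) 0 (enum_rank s) = lin_cost (arc_matrix c) (tour_arcs s).
  move=> ts; rewrite mxE /lin_cost [RHS]big_mkcond (reindex_onto enum_rank enum_val) /=.
    apply: eq_big => [e|e _]; first by rewrite enum_rankK eqxx.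
    rewrite !mxE !enum_rankK ts /=; case: ifP => eT; last by rewrite mulr0.
    rewrite mulr1; case: insubP => [e' _ e'E|].
      by congr (c 0 (enum_rank _)); apply: val_inj; rewrite e'E -surjective_pairing.
    by rewrite (valP e).
  by move=> i _; rewrite enum_valK.
have rhs (s : n.-tuple 'I_n) : is_tour_tuple s ->
    (pair_row Q *m pair_incidence R) 0 (enum_rank s) = quad_cost Q (tour_arcs s).
  move=> ts; rewrite mxE /quad_cost [RHS]big_mkcond (reindex_onto enum_rank enum_val) /=.
    apply: eq_big => [e|e _]; first by rewrite enum_rankK eqxx.
    rewrite !mxE !enum_rankK ts /=.
    by case: ifP => eT; rewrite ?mulr0 ?mulr1.
  by move=> i _; rewrite enum_valK.
split=> [lin|eqs tau [s [cs szs ->]]].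
  apply/rowP => s; case: (boolP (is_tour_tuple (enum_val s))) => ts.
    rewrite -[s]enum_valK lhs // rhs // lin //; exists (enum_val s).
    by split=> //; rewrite ?size_tuple //; apply: ts.
  rewrite !mxE !big1 // => e _; rewrite !mxE (negbTE ts) mulr0 //.
have szs' : size s == n by apply/eqP.
have := @lhs (Tuple szs') cs; have := @rhs (Tuple szs') cs.
by rewrite /tour_arcs /= -eqs => <- <-.
Qed.

Lemma linearizable_row (Q : {ffun P -> R}) :
  linearizable Q <-> exists c, is_linearization Q (arc_matrix c).
Proof.
split=> [[C lC]|[c lc]]; last by exists (arc_matrix c).
exists (\row_e C (arc_tail (enum_val e)) (arc_head (enum_val e))) => tau ttau.
rewrite (lC tau ttau); apply: eq_bigr => e _; rewrite mxE.
case: insubP => [e' _ e'E|]; last by rewrite (valP e).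
rewrite mxE enum_rankK.
by have -> : e' = e by apply: val_inj; rewrite e'E -surjective_pairing.
Qed.

(** The incidence matrices are 0-1 matrices, so cokernel and pseudo-inverse can be formed over the
    rationals and then mapped to [R]. Their entries are thus quotients of integers, which a program
    can express. *)
Definition residue_mx : 'M[rat]_(#|{: P}|, #|{: n.-tuple 'I_n}|) :=
  pair_incidence rat *m cokermx (arc_incidence rat).

Definition solution_mx : 'M[rat]_(#|{: P}|, #|{: E}|) :=
  pair_incidence rat *m pinvmx (arc_incidence rat).

Lemma rational_solution (Q : {ffun P -> R}) :
  (linearizable Q <-> pair_row Q *m map_mx (@ratr R) residue_mx = 0)
  /\ (linearizable Q ->
      is_linearization Q (arc_matrix (pair_row Q *m map_mx (@ratr R) solution_mx))).
Proof.
have mapA : map_mx (@ratr R) (arc_incidence rat) = arc_incidence R.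
  by apply/matrixP => e s; rewrite !mxE rmorph_nat.
have mapP : map_mx (@ratr R) (pair_incidence rat) = pair_incidence R.
  by apply/matrixP => e s; rewrite !mxE rmorph_nat.
rewrite /residue_mx /solution_mx ![map_mx _ (pair_incidence rat *m _)]map_mxM map_cokermx map_pinvmx mapA mapP ![pair_row Q *m (_ *m _)]mulmxA.
have linE : linearizable Q <-> (pair_row Q *m pair_incidence R <= arc_incidence R)%MS.
  rewrite linearizable_row; split=> [[c /linearization_row <-]|]; first exact: submxMl.
  by case/submxP=> c cE; exists c; apply/linearization_row.
split; first by rewrite linE submxE; split=> /eqP.
by move/linE => sub; apply/linearization_row; rewrite mulmxKpV.
Qed.

Definition int_expr (z : int) : rexpr :=
  match z with
  | Posz m => ROfInt (IConst m)
  | Negz m => RSub (ROfInt (IConst 0)) (ROfInt (IConst m.+1))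
  end.

Definition rat_expr (x : rat) : rexpr := RDiv (int_expr (numq x)) (int_expr (denq x)).

Lemma reval_rat (s : store R) x : reval s (rat_expr x) = ratr x.
Proof.
have ints z : reval s (int_expr z) = z%:~R.
  by case: z => m //=; rewrite NegzE sub0r mulrNz.
by rewrite /= !ints.
Qed.

Definition sum_expr (es : seq rexpr) : rexpr := foldr RAdd (ROfInt (IConst 0)) es.

Lemma reval_sum (s : store R) es : reval s (sum_expr es) = \sum_(e <- es) reval s e.
Proof. by elim: es => [|e es IHes] /=; rewrite ?big_nil ?big_cons // IHes. Qed.

Definition input_cell (p : P) : seq iexpr :=
  [:: IConst (val (arc_tail p.1)); IConst (val (arc_head p.1));
      IConst (val (arc_tail p.2)); IConst (val (arc_head p.2))].

Definition lin_expr m (W : 'M[rat]_(#|{: P}|, m)) (j : 'I_m) : rexpr :=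
  sum_expr [seq RMul (RGet 0 (input_cell (enum_val p))) (rat_expr (W p j))
           | p <- enum 'I_#|{: P}|].

Lemma reval_lin m (W : 'M[rat]_(#|{: P}|, m)) (j : 'I_m) (Q : {ffun P -> R}) (s : store R) :
  (forall e f : E, real_mem s 0 [:: val (arc_tail e); val (arc_head e);
                     val (arc_tail f); val (arc_head f)] = Q (e, f)) ->
  reval s (lin_expr W j) = (pair_row Q *m map_mx (@ratr R) W) 0 j.
Proof.
move=> inQ; rewrite reval_sum big_map mxE big_enum /=; apply: eq_bigr => p _.
by rewrite !mxE inQ -surjective_pairing -[_ / _]/(reval s (rat_expr _)) reval_rat.
Qed.

(** Array 0 is never written, so the expressions keep their values throughout. *)
Lemma exec_writes (T : eqType) (L : seq T) (ix : T -> seq iexpr) (jx : T -> seq nat)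
    (e : T -> rexpr) (v : T -> R) (m0 : seq nat -> R) (s : store R) :
  real_mem s 0 = m0 -> injective jx ->
  (forall x s', real_mem s' 0 = m0 -> map (ieval s') (ix x) = jx x /\ reval s' (e x) = v x) ->
  exists s', [/\ exec (foldr (fun x c => Seq (RSet 1 (ix x) (e x)) c) Skip L) s
      (foldr (fun x t => (sumn (map icost (ix x)) + rcost (e x)).+1 + t)%N 1%N L) s',
      int_mem s' = int_mem s,
      forall x, x \in L -> real_mem s' 1 (jx x) = v x
    & forall y, (forall x, x \in L -> jx x != y) -> real_mem s' 1 y = real_mem s 1 y].
Proof.
move=> s0 jx_inj ev; elim: L s s0 => [|x L IHL] s s0 /=.
  by exists s; split=> //; constructor.
have [ixE eE] := ev x s s0.
have [|s' [ex is' vs' os']] := IHL (Store (int_mem s)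
    (update (real_mem s) 1 (map (ieval s) (ix x)) (reval s (e x)))).
  by rewrite -s0.
exists s'; split=> //.
- by apply: ExecSeq ex; constructor.
- move=> y; rewrite inE; case: (boolP (y \in L)) => [yL _|yL]; first exact: vs'.
  rewrite orbF => /eqP ->; case: (boolP (x \in L)) => xL; first exact: vs'.
  rewrite os'; first by rewrite /= /update ixE eE !eqxx.
  by move=> z zL; apply: contraNneq xL => /jx_inj <-.
- move=> y ny; rewrite os'; last by move=> z zL; rewrite ny // inE zL orbT.
  by rewrite /= /update ixE [y == _]eq_sym (negbTE (ny x (mem_head _ _))).
Qed.

Lemma solves_fixed : exists c K, solves R n c K.
Proof.
pose sq r := RMul r r.
(* A sum of squares is at most 0 exactly when the whole residue vector vanishes. *)
pose err := sum_expr [seq sq (lin_expr residue_mx j) | j <- enum 'I_#|{: n.-tuple 'I_n}|].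
pose ans := If (TRLe err (ROfInt (IConst 0))) (ISet 1 [::] (IConst 1)) (ISet 1 [::] (IConst 0)).
pose ix (e : E) := [:: IConst (val (arc_tail e)); IConst (val (arc_head e))].
pose wr := foldr (fun e c => Seq (RSet 1 (ix e) (lin_expr solution_mx (enum_rank e))) c) Skip (enum {: E}).
(* The bound left open becomes the exact running time, which depends on neither [Q] nor the
   store. *)
exists (Seq ans wr); eexists => Q s [sn inQ].
have [linE linS] := rational_solution Q.
have errE : (reval s err <= 0) = (pair_row Q *m map_mx (@ratr R) residue_mx == 0).
  rewrite /err reval_sum big_map big_enum /=.
  set r := _ *m _.
  have -> : \sum_j reval s (lin_expr residue_mx j) * reval s (lin_expr residue_mx j)
      = \sum_j r 0 j ^+ 2 by apply: eq_bigr => j _; rewrite (reval_lin _ _ inQ) expr2.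
  rewrite le_eqVlt ltNge sumr_ge0 ?orbF => [|j _]; last exact: sqr_ge0.
  rewrite psumr_eq0 => [|j _]; last exact: sqr_ge0.
  apply/idP/eqP => [/allP r0|->]; last by apply/allP => j _; rewrite mxE expr0n eqxx.
  apply/rowP => j; rewrite [RHS]mxE; apply/eqP.
  by have := r0 j (mem_index_enum j); rewrite /= sqrf_eq0.
pose b := reval s err <= 0.
pose s1 := Store (update (int_mem s) 1 [::] b) (real_mem s).
have ex1 : exec ans s (tcost (TRLe err (ROfInt (IConst 0))) + 2).+1 s1.
  have tb : teval s (TRLe err (ROfInt (IConst 0))) = b by [].
  rewrite /ans; apply: ExecIf; rewrite tb /s1.
  by case: (b); apply: (ExecISet s 1 [::] (IConst _)).
have [|||s2 [ex2 is2 v2 _]] := @exec_writes E (enum {: E}) ix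
   (fun e => [:: val (arc_tail e); val (arc_head e)])
   (fun e => lin_expr solution_mx (enum_rank e))
   (fun e => (pair_row Q *m map_mx (@ratr R) solution_mx) 0 (enum_rank e))
   (real_mem s 0) s1.
- by [].
- by move=> e f [e1 e2]; apply: val_inj; rewrite [val e]surjective_pairing
    [val f]surjective_pairing; congr (_, _); apply: val_inj.
- by move=> e s' s'0; split=> //; apply: reval_lin => e1 e2; rewrite s'0.
exists ((tcost (TRLe err (ROfInt (IConst 0))) + 2).+1 + 
  (foldr (fun x t => (sumn (map icost (ix x)) + rcost (lin_expr solution_mx (enum_rank x))).+1 + t)%N 1%N (enum {: E})))%N, s2.
split=> //.
- exact: ExecSeq ex1 ex2.
- rewrite /answers_yes is2 /= /update /= linE eqb0 negbK /b errE.
  by split=> /eqP.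
- move=> /linS lin tau ttau; rewrite (lin tau ttau); apply: eq_bigr => e _.
  rewrite mxE [RHS]mxE v2 ?mem_enum //; case: insubP => [e' _ e'E|].
    by have -> : e' = e by apply: val_inj; rewrite e'E -surjective_pairing.
  by rewrite (valP e).
Qed.

End FixedSize.

(** * Loop programs *)

Definition var (v : nat) : iexpr := IGet v [::].

Definition loop (v : nat) (c : cmd) : cmd :=
  Seq (ISet v [::] (IConst 0))
    (While (TNot (TILe (var 0) (var v)))
       (Seq c (ISet v [::] (IAdd (var v) (IConst 1))))).

(* All arrays are filled by nests of exactly four loops: a cell with fewer than
   four indices is visited several times. *)
Definition nest (a : nat) (ix : seq iexpr) (e : rexpr) : cmd :=
  foldr loop (RSet a ix e) [:: 2; 3; 4; 5]%N.

(** The list is in the order in which [d] nested loops run through their index tuples. *)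
Fixpoint words (n d : nat) : seq (seq nat) :=
  if d is d'.+1 then flatten [seq [seq i :: w | w <- words n d'] | i <- iota 0 n]
  else [:: [::]].

Lemma mem_words n d w : (w \in words n d) = (size w == d) && all (fun i => i < n)%N w.
Proof.
elim: d w => [|d IHd] w; first by rewrite inE; case: w.
apply/flatten_mapP/andP => [[i]|].
  rewrite mem_iota => ii /mapP[w']; rewrite IHd => /andP[/eqP sz aw] ->.
  by rewrite /= sz eqxx; split=> //; apply/andP.
case: w => [|i w] [//= sz /andP[ii aw]]; exists i; rewrite ?mem_iota //.
by apply/mapP; exists w; rewrite // IHd aw andbT.
Qed.

Section Programs.

Variables (R : realType) (n : nat).
Hypothesis n_gt0 : (0 < n)%N.

Local Notation mem := (nat -> seq nat -> R).

Definition state (env : seq (nat * nat)) (M : mem) (s : store R) : Prop :=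
  all (fun p => int_mem s p.1 [::] == p.2) env /\ real_mem s = M.

Lemma state_set_int env M s v i : v \notin map fst env -> state env M s ->
  state ((v, i) :: env) M (Store (update (int_mem s) v [::] i) (real_mem s)).
Proof.
move=> vE [es ->]; split=> //=; rewrite /update !eqxx /=.
apply/allP => p pe; rewrite andbT; case: (eqVneq p.1 v) => [pv|_]; last exact: (allP es _ pe).
by case/negP: vE; rewrite -pv map_f.
Qed.

Lemma exec_loop (G : mem -> Prop) v c B (F : mem -> nat -> mem) env :
  v \notin map fst env -> (0%N, n) \in env ->
  (forall i M, (i < n)%N -> G M -> G (F M i)) ->
  (forall i M s, (i < n)%N -> G M -> state ((v, i) :: env) M s ->
     exists t s', [/\ exec c s t s', (t <= B)%N & state ((v, i) :: env) (F M i) s']) ->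
  forall M s, G M -> state env M s ->
  exists t s', [/\ exec (loop v c) s t s', (t <= (B + 16) * n)%N
    & state env (foldl F M (iota 0 n)) s'].
Proof.
move=> vE nE GF body M s GM ss.
have steps d i M' s' : (i + d = n)%N -> G M' -> state ((v, i) :: env) M' s' ->
    exists t s'', [/\ exec (While (TNot (TILe (var 0) (var v)))
       (Seq c (ISet v [::] (IAdd (var v) (IConst 1))))) s' t s'',
      (t <= (B + 9) * d + 5)%N & state env (foldl F M' (iota i d)) s''].
  elim: d i M' s' => [|d IHd] i M' s' id GM' [/= /andP[/eqP vi es] rs].
    exists 5, s'; split; [|by rewrite muln0|by []].
    apply: ExecWhileStop => /=.
    by rewrite negbK vi (eqP (allP es _ nE)) -id addn0.
  have ii : (i < n)%N by rewrite -id addnS ltnS leq_addr.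
  have [t [s2 [ex2 t2 ss2]]] :=
    body i M' s' ii GM' (conj (introT andP (conj (introT eqP vi) es)) rs).
  have := ss2 => -[/= /andP[/eqP vi2 es2] rs2].
  pose s3 := Store (update (int_mem s2) v [::] i.+1) (real_mem s2).
  have ss3 : state ((v, i.+1) :: env) (F M' i) s3.
    by rewrite -rs2; apply: state_set_int => //.
  have [|t' [s4 [ex4 t4 ss4]]] := IHd i.+1 (F M' i) s3 _ (GF _ _ ii GM') ss3;
    first by rewrite addSnnS.
  exists (4 + (t + 4) + t').+1, s4; split=> //; last by lia.
  apply: (@ExecWhileStep _ _ _ _ _ s3); last exact: ex4.
    by rewrite /= vi (eqP (allP es _ nE)) -ltnNge -id addnS ltnS leq_addr.
  apply: ExecSeq ex2 _; rewrite /s3 (_ : i.+1 = ieval s2 (IAdd (var v) (IConst 1))); last by rewrite /= vi2 addn1.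
  exact: (@ExecISet _ s2 v [::] (IAdd (var v) (IConst 1))).
have ss0 := @state_set_int env M s v 0 vE ss.
have [|t [s2 [ex2 t2 ss2]]] := steps n 0%N M _ _ GM ss0; first by rewrite add0n.
(* Initialization and final test cost 7 in all, absorbed by [7 * n] because n is positive; this
   turns 9 into 16. *)
exists (2 + t)%N, s2; split=> //; last by nia.
by apply: ExecSeq ex2; apply: (@ExecISet _ s v [::] (IConst 0)).
Qed.

Lemma exec_loops (G : mem -> Prop) vs : forall c B (F : mem -> seq nat -> mem) env,
  uniq (vs ++ map fst env) -> (0%N, n) \in env ->
  (forall w M, w \in words n (size vs) -> G M -> G (F M w)) ->
  (forall w M s, w \in words n (size vs) -> G M -> state (catrev (zip vs w) env) M s ->
     exists t s', [/\ exec c s t s', (t <= B)%N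
       & state (catrev (zip vs w) env) (F M w) s']) ->
  forall M s, G M -> state env M s ->
  exists t s', [/\ exec (foldr loop c vs) s t s',
    (t <= (B + 16 * size vs) * n ^ size vs)%N
    & state env (foldl F M (words n (size vs))) s'].
Proof.
elim: vs => [|v vs IHvs] c B F env us nE GF body M s GM ss /=.
  have [t [s' [ex tB ss']]] := body [::] M s isT GM ss.
  by exists t, s'; split=> //; rewrite muln0 addn0 expn0 muln1.
move: us; rewrite /= mem_cat negb_or => /andP[/andP[vvs vE] us].
have consW i w : (i < n)%N -> w \in words n (size vs) -> i :: w \in words n (size vs).+1.
  by move=> ii; rewrite !mem_words /= eqSS ii.
have [i M' ii|i M' s' ii GM' ss'|t [s' [ex tB ss']]] := @exec_loop G v (foldr loop c vs)
    ((B + 16 * size vs) * n ^ size vs)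
    (fun M i => foldl (fun M w => F M (i :: w)) M (words n (size vs))) env vE nE _ _ M s GM ss.
- have : forall W, {subset W <= words n (size vs)} ->
      forall M2, G M2 -> G (foldl (fun M w => F M (i :: w)) M2 W).
    elim=> [|w W IHW] sub M2 GM2 //=; apply: IHW => [w' w'W|]; last first.
      by apply: GF => //; apply: consW => //; apply: sub; rewrite mem_head.
    by apply: sub; rewrite inE w'W orbT.
  by apply.
- apply: IHvs ss' => [||w M2 wW GM2|w M2 s2 wW GM2 ss2|//].
  + by rewrite uniq_catC /= mem_cat negb_or vE vvs /= uniq_catC.
  + by rewrite inE nE orbT.
  + by apply: GF => //; apply: consW.
  + by apply: (body (i :: w)) => //; apply: consW.
exists t, s'; split=> //.
  apply: leq_trans tB _; rewrite expnS.
  have : (n <= n * n ^ size vs)%N by rewrite leq_pmulr // expn_gt0 n_gt0.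
  move=> nX; rewrite (_ : B + 16 * (size vs).+1 = B + 16 * size vs + 16)%N; last by lia.
  move: (B + 16 * size vs)%N => K.
  by rewrite !mulnDl -mulnA (mulnC (n ^ _)%N) leq_add2l leq_mul2l nX orbT.
suff <- : foldl (fun M i => foldl (fun M w => F M (i :: w)) M (words n (size vs))) M (iota 0 n)
   = foldl F M (flatten [seq [seq i :: w | w <- words n (size vs)] | i <- iota 0 n]) by [].
elim: (iota 0 n) M {ss GM ss' ex} => [|i r IHr] M //=.
rewrite foldl_cat -IHr; congr (foldl _ _ _).
by elim: (words n (size vs)) M => //= w W IHW M; rewrite IHW.
Qed.

Definition loop_vars (w : seq nat) (s : store R) : Prop :=
  [/\ int_mem s 0 [::] = n, int_mem s 2 [::] = nth 0 w 0, int_mem s 3 [::] = nth 0 w 1,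
      int_mem s 4 [::] = nth 0 w 2 & int_mem s 5 [::] = nth 0 w 3]%N.

(** 64 is the overhead 16 of [exec_loop] for each of the four loops. *)
Definition nest_cost (ix : seq iexpr) (e : rexpr) : nat :=
  ((sumn (map icost ix) + rcost e).+1 + 64)%N.

Lemma exec_nest (a : nat) ix e (jx : seq nat -> seq nat) (f : mem -> seq nat -> R)
    (G : mem -> Prop) (M : mem) (s : store R) :
  (forall w s', w \in words n 4 -> loop_vars w s' -> G (real_mem s') ->
     map (ieval s') ix = jx w /\ reval s' e = f (real_mem s') w) ->
  (forall M' w v, G M' -> w \in words n 4 -> G (update M' a (jx w) v)) ->
  G M -> int_mem s 0 [::] = n -> real_mem s = M ->
  exists t s', [/\ exec (nest a ix e) s t s', (t <= nest_cost ix e * n ^ 4)%N,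
    int_mem s' 0 [::] = n
    & real_mem s' = foldl (fun M w => update M a (jx w) (f M w)) M (words n 4)].
Proof.
move=> ev GU GM sn sM.
have ss : state [:: (0%N, n)] M s by split; rewrite //= sn eqxx.
have [|||w M' s' wW GM' ss'|t [s' [ex tB [/= /andP[/eqP s'n _] rE]]]] :=
  @exec_loops G [:: 2; 3; 4; 5]%N (RSet a ix e) (sumn (map icost ix) + rcost e).+1
    (fun M w => update M a (jx w) (f M w)) [:: (0%N, n)] _ _ _ _ M s GM ss.
- by [].
- by rewrite mem_head.
- by move=> w M' wW GM'; apply: GU.
- have lv : loop_vars w s'.
    move: wW ss'; rewrite mem_words => /andP[/eqP sz _].
    case: w sz => [|w1 [|w2 [|w3 [|w4 [|]]]]] //= _ [/= + _].
    by case/and5P=> /eqP v5 /eqP v4 /eqP v3 /eqP v2 /andP[/eqP v0 _]; split.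
  case: ss' => es' rs'; rewrite -rs' in GM' *.
  have [ixE eE] := ev w s' wW lv GM'.
  eexists; eexists; split; first exact: ExecRSet.
    exact: leqnn.
  by split=> //=; rewrite ixE eE.
by exists t, s'.
Qed.

End Programs.

(** * Filling and summing arrays within a multiple of n^4 steps *)

Section Phases.

Variables (R : realType) (n : nat).
Hypothesis n_gt0 : (0 < n)%N.

Local Notation mem := (nat -> seq nat -> R).

Definition achieves (pre : store R -> Prop) (c : cmd) (B : nat)
    (post : store R -> Prop) : Prop :=
  forall s, pre s -> exists t s', [/\ exec c s t s', (t <= B * n ^ 4)%N & post s'].

Lemma achieves_seq pre mid post c1 c2 B1 B2 :
  achieves pre c1 B1 mid -> achieves mid c2 B2 post ->
  achieves pre (Seq c1 c2) (B1 + B2) post.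
Proof.
move=> h1 h2 s /h1[t1 [s1 [e1 b1 /h2[t2 [s2 [e2 b2 q]]]]]].
exists (t1 + t2)%N, s2; split=> //; first exact: ExecSeq e1 e2.
by rewrite mulnDl leq_add.
Qed.

Definition sized (G : mem -> Prop) (s : store R) : Prop :=
  int_mem s 0 [::] = n /\ G (real_mem s).

Definition ignores (a : nat) (G : mem -> Prop) : Prop :=
  forall M y v, G M -> G (update M a y v).

(** The value depends on the cell alone, so repeated visits write the same number; it is computed
    from [G], which the writes to array [a] preserve. *)
Lemma achieves_fill a ix e (jx : seq nat -> seq nat) (val : seq nat -> R) (G : mem -> Prop) :
  ignores a G ->
  (forall w s, w \in words n 4 -> loop_vars n w s -> G (real_mem s) ->
     map (ieval s) ix = jx w /\ reval s e = val (jx w)) ->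
  achieves (sized G) (nest a ix e) (nest_cost ix e)
    (sized (fun M => G M /\ forall w, w \in words n 4 -> M a (jx w) = val (jx w))).
Proof.
move=> ign ev s [sn Gs].
have [|t [s' [ex tB s'n rE]]] := @exec_nest R n n_gt0 a ix e jx
  (fun _ w => val (jx w)) G (real_mem s) s ev _ Gs sn erefl.
  by move=> M w v GM _; apply: ign.
exists t, s'; split=> //; split=> //; rewrite rE.
move: (words n 4) (real_mem s) Gs {ex s'n rE sn ev}.
elim/last_ind => [|W w IHW] M GM; first by split.
have [G' val'] := IHW M GM.
rewrite foldl_rcons; split; first exact: ign.
move=> w'; rewrite mem_rcons inE /update eqxx /=.
case: (eqVneq (jx w') (jx w)) => [-> //|ne] /predU1P[ww'|]; last exact: val'.
by rewrite ww' eqxx in ne.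
Qed.

(** Here repeated visits accumulate: a cell collects the contributions of all words that address
    it. *)
Lemma achieves_sum a ix e (jx : seq nat -> seq nat) (h : seq nat -> R) (m0 : seq nat -> R)
    (G : mem -> Prop) :
  ignores a G ->
  (forall w s, w \in words n 4 -> loop_vars n w s -> G (real_mem s) ->
     map (ieval s) ix = jx w /\ reval s e = real_mem s a (jx w) + h w) ->
  achieves (sized (fun M => G M /\ forall w, w \in words n 4 -> M a (jx w) = m0 (jx w)))
    (nest a ix e) (nest_cost ix e)
    (sized (fun M => G M /\ forall w, w \in words n 4 ->
       M a (jx w) = m0 (jx w) + \sum_(w' <- words n 4 | jx w' == jx w) h w')).
Proof.
move=> ign ev s [sn [Gs ms]].
have [|t [s' [ex tB s'n rE]]] := @exec_nest R n n_gt0 a ix e jx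
  (fun M w => M a (jx w) + h w) G (real_mem s) s ev _ Gs sn erefl.
  by move=> M w v GM _; apply: ign.
exists t, s'; split=> //; split=> //; rewrite rE.
have fold W M : G M -> G (foldl (fun M w => update M a (jx w) (M a (jx w) + h w)) M W)
   /\ forall y, foldl (fun M w => update M a (jx w) (M a (jx w) + h w)) M W a y
       = M a y + \sum_(w' <- W | jx w' == y) h w'.
  elim/last_ind: W M => [|W w IHW] M GM.
    by split=> // y; rewrite big_nil addr0.
  have [G' sum'] := IHW M GM.
  rewrite foldl_rcons; split=> [|y]; first exact: ign.
  rewrite -cats1 big_cat /= big_cons big_nil /update eqxx /= (eq_sym y).
  by case: (eqVneq (jx w) y) => [<-|_]; rewrite sum' ?addr0 ?addrA.
have [G' sum'] := fold (words n 4) _ Gs.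
by split=> // w wW; rewrite sum' ms.
Qed.

Lemma sum_words (F : seq nat -> R) :
  \sum_(w <- words n 4) F w =
  \sum_(i <- iota 0 n) \sum_(j <- iota 0 n) \sum_(k <- iota 0 n) \sum_(m <- iota 0 n)
     F [:: i; j; k; m].
Proof.
have unfold_words d (F' : seq nat -> R) :
    \sum_(w <- words n d.+1) F' w = \sum_(i <- iota 0 n) \sum_(w <- words n d) F' (i :: w).
  by rewrite big_flatten big_map; apply: eq_bigr => i _; rewrite big_map.
rewrite unfold_words; apply: eq_bigr => i _; rewrite unfold_words; apply: eq_bigr => j _.
rewrite unfold_words; apply: eq_bigr => k _; rewrite unfold_words; apply: eq_bigr => m _.
by rewrite big_seq1.
Qed.

Lemma sum_iota_eq (F : nat -> R) i : (i < n)%N ->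
  \sum_(j <- iota 0 n) (if j == i then F j else 0) = F i.
Proof.
move=> ii; rewrite -big_mkcond -big_filter filter_pred1_uniq ?iota_uniq ?mem_iota //.
by rewrite big_seq1.
Qed.

End Phases.

(** * Equality tests and picks by truncated subtraction *)

Definition eq_expr (e1 e2 : iexpr) : iexpr :=
  ISub (IConst 1) (IAdd (ISub e1 e2) (ISub e2 e1)).
Definition pick2_expr (c : nat) (i : iexpr) : iexpr :=
  IAdd (IConst c) (eq_expr i (IConst c)).
(** [1 - (1 - x)] caps [x] at 1, for the case that both indices equal [c]. *)
Definition either_expr (i k : iexpr) (c : nat) : iexpr :=
  ISub (IConst 1) (ISub (IConst 1) (IAdd (eq_expr i (IConst c)) (eq_expr k (IConst c)))).
(** [x - (x - y)] is the minimum of [x] and [y]: the second increment occurs only if both [c] and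
    [c + 1] are taken. *)
Definition pick3_expr (c : nat) (i k : iexpr) : iexpr :=
  IAdd (IAdd (IConst c) (either_expr i k c))
    (ISub (either_expr i k c) (ISub (either_expr i k c) (either_expr i k c.+1))).

Section Evaluation.

Variables (R : realType) (s : store R).

Lemma ieval_const k : ieval s (IConst k) = k. Proof. by []. Qed.
Lemma ieval_var v : ieval s (var v) = int_mem s v [::]. Proof. by []. Qed.
Lemma ieval_add e1 e2 : ieval s (IAdd e1 e2) = (ieval s e1 + ieval s e2)%N.
Proof. by []. Qed.
Lemma ieval_sub e1 e2 : ieval s (ISub e1 e2) = (ieval s e1 - ieval s e2)%N.
Proof. by []. Qed.

Lemma ieval_eq e1 e2 : ieval s (eq_expr e1 e2) = (ieval s e1 == ieval s e2) :> nat.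
Proof.
rewrite /eq_expr !(ieval_sub, ieval_add, ieval_const).
by case: eqVneq => ?; lia.
Qed.

Lemma ieval_pick2 c i : ieval s (pick2_expr c i) = pick2 c (ieval s i).
Proof.
rewrite /pick2_expr ieval_add ieval_eq ieval_const /pick2.
by case: eqVneq => ?; lia.
Qed.

Lemma ieval_pick3 c i k :
  ieval s (pick3_expr c i k) = pick3 c (ieval s i) (ieval s k).
Proof.
rewrite /pick3_expr /either_expr !(ieval_sub, ieval_add, ieval_const, ieval_eq) /pick3.
by do 4 case: eqVneq => ? /=; lia.
Qed.

Lemma map_ieval_nil : map (ieval s) [::] = [::]. Proof. by []. Qed.
Lemma reval_int e : reval s (ROfInt e) = (ieval s e)%:R. Proof. by []. Qed.
Lemma reval_get a ix : reval s (RGet a ix) = real_mem s a (map (ieval s) ix).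
Proof. by []. Qed.
Lemma reval_add e1 e2 : reval s (RAdd e1 e2) = reval s e1 + reval s e2.
Proof. by []. Qed.
Lemma reval_sub e1 e2 : reval s (RSub e1 e2) = reval s e1 - reval s e2.
Proof. by []. Qed.
Lemma reval_mul e1 e2 : reval s (RMul e1 e2) = reval s e1 * reval s e2.
Proof. by []. Qed.
Lemma reval_div e1 e2 : reval s (RDiv e1 e2) = reval s e1 / reval s e2.
Proof. by []. Qed.

Definition evalE := (reval_int, reval_get, reval_add, reval_sub, reval_mul, reval_div,
  map_cons, map_ieval_nil, ieval_pick2, ieval_pick3, ieval_eq, ieval_const, ieval_var).

End Evaluation.

(** * The expressions evaluated by the algorithm *)

Local Notation vi := (var 2).
Local Notation vj := (var 3).
Local Notation vk := (var 4).
Local Notation vm := (var 5).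
Local Notation "k %:c" := (IConst k) (at level 2).
Local Notation "[ e1 =? e2 ]" := (ROfInt (eq_expr e1 e2)).
Local Notation "[ e1 =/ e2 ]" := (RSub (ROfInt (IConst 1)) (ROfInt (eq_expr e1 e2))).

Definition sym_expr i j k m := RAdd (RGet 0 [:: i; j; k; m]) (RGet 0 [:: k; m; i; j]).

(* Array 2: the reduced cost; 3 and 4: cand_w and cand_u; 5: cand_A; 6: cand_D;
   7: cand_t; 8 and 9: the splitting; 10: the squared residue of the splitting. *)
Definition reduced_expr : rexpr :=
  RAdd (RAdd (RSub (RSub (RSub (RSub (sym_expr vi vj vk vm)
    (sym_expr vi vj 0%:c vm)) (sym_expr vi vj vk 0%:c)) (sym_expr vk vm 0%:c vj))
    (sym_expr vk vm vi 0%:c)) (sym_expr 0%:c vm vi 0%:c)) (sym_expr 0%:c vj vk 0%:c).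

Definition swap_expr i j k m := RSub (RGet 2 [:: i; j; k; m]) (RGet 2 [:: i; m; k; j]).

Definition w_expr := swap_expr vi vj 1%:c (pick2_expr 2 vi).

Definition u_expr :=
  RAdd (RMul [vj =/ 1%:c] (RGet 3 [:: vi; vj]))
    (RMul [vj =? 1%:c]
      (RSub (RAdd (swap_expr vi 1%:c 2%:c (pick2_expr 3 vi))
                  (RGet 3 [:: vi; pick2_expr 3 vi]))
            (RGet 3 [:: 2%:c; pick2_expr 3 vi]))).

Definition y_expr i j k m :=
  RSub (RSub (RGet 2 [:: i; j; k; m]) (RGet 4 [:: i; j])) (RGet 4 [:: k; m]).

Definition A_expr :=
  RDiv (RSub (y_expr vi (pick3_expr 3 vi vj) vj (pick3_expr 6 vi vj))
             (y_expr 1%:c (pick3_expr 3 vi vj) 2%:c (pick3_expr 6 vi vj)))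
       (ROfInt 2%:c).

Definition D_expr :=
  RSub (RDiv (y_expr (pick3_expr 3 vi vj) vi (pick3_expr 6 vi vj) vj) (ROfInt 2%:c))
       (RGet 5 [:: pick3_expr 3 vi vj; pick3_expr 6 vi vj]).

Definition t_expr :=
  RSub (RSub (RSub (RSub (y_expr (pick2_expr 3 vi) vi vi (pick2_expr 5 vi))
    (RGet 5 [:: pick2_expr 3 vi; vi])) (RGet 5 [:: vi; pick2_expr 3 vi]))
    (RGet 6 [:: vi; pick2_expr 5 vi])) (RGet 6 [:: pick2_expr 5 vi; vi]).

Definition neg_expr e := RSub (ROfInt 0%:c) e.

Definition tail_expr :=
  RMul [vk =/ 0%:c]
    (RAdd (RMul [vj =? 0%:c] (neg_expr (RGet 5 [:: vk; vi])))
      (RMul [vj =/ 0%:c] (RAdd (sym_expr vi vj vk 0%:c)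
        (RMul [vi =/ 0%:c] (RAdd (RAdd (RGet 5 [:: vi; vk]) (RGet 4 [:: vi; vj]))
          (RMul [vj =? vk] (RGet 7 [:: vj]))))))).

Definition head_expr :=
  RAdd (RMul (RMul [vk =? 0%:c] [vi =/ 0%:c]) (neg_expr (RGet 4 [:: vi; vj])))
    (RMul [vk =/ 0%:c] (RAdd (RMul [vi =? 0%:c] (neg_expr (RGet 6 [:: vk; vj])))
      (RMul [vi =/ 0%:c]
        (RAdd (RMul [vj =? 0%:c] (neg_expr (RMul [vi =? vk] (RGet 7 [:: vk]))))
          (RMul [vj =/ 0%:c]
            (RAdd (RSub (sym_expr vi vj 0%:c vk) (sym_expr 0%:c vk vi 0%:c))
              (RGet 6 [:: vj; vk]))))))).

Definition residue_expr :=
  RSub (sym_expr vi vj vk vm)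
    (RAdd (RAdd (RAdd (RGet 8 [:: vi; vj; vk]) (RGet 9 [:: vi; vj; vm]))
      (RGet 8 [:: vk; vm; vi])) (RGet 9 [:: vk; vm; vj])).

(** This factor is 0 on incompatible quadruples, whose cells may hold arbitrary numbers. *)
Definition compatible_expr :=
  RMul (RMul [vi =/ vj] [vk =/ vm]) (RMul (RMul [vi =/ vk] [vj =/ vm])
    (RSub (ROfInt 1%:c) (RMul [vi =? vm] [vj =? vk]))).

Definition penalty_expr :=
  RAdd (RGet 10 [::]) (RMul compatible_expr (RMul residue_expr residue_expr)).

(* The guard on the fourth loop variable keeps each summand from being added n times. *)
Definition coef_expr :=
  RAdd (RGet 1 [:: vi; vj])
    (RMul [vm =? 0%:c] (RAdd (RMul [vk =/ vi] (RGet 8 [:: vi; vj; vk]))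
                            (RMul [vk =/ vj] (RGet 9 [:: vi; vj; vk])))).

(** * Contents of the auxiliary arrays *)

Section Facts.

Variables (R : realType) (n : nat) (q : nat -> nat -> nat -> nat -> R).
Hypothesis n_gt : (50 < n)%N.

Local Notation g := (reduced_cost q).

Definition cell (a : nat) (w : seq nat) : seq nat :=
  match a with
  | 0 | 2 => [:: nth 0 w 0; nth 0 w 1; nth 0 w 2; nth 0 w 3]
  | 7 => [:: nth 0 w 0]
  | 8 | 9 => [:: nth 0 w 0; nth 0 w 1; nth 0 w 2]
  | 10 => [::]
  | _ => [:: nth 0 w 0; nth 0 w 1]
  end%N.

(** Array 1 is an accumulator: its entry here is the initial value, the diagonal term of
    [split_coef]. *)
Definition content (a : nat) (y : seq nat) : R :=
  let i := nth 0%N y 0 in let j := nth 0%N y 1 in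
  let k := nth 0%N y 2 in let m := nth 0%N y 3 in
  match a with
  | 0 => q i j k m
  | 1 => q i j i j
  | 2 => g i j k m
  | 3 => cand_w g i j
  | 4 => cand_u g i j
  | 5 => cand_A g i j
  | 6 => cand_D g i j
  | 7 => cand_t g i
  | 8 => cand_tail q i j k
  | 9 => cand_head q i j k
  | _ => 0
  end.

Definition filled (a : nat) (M : nat -> seq nat -> R) : Prop :=
  forall w, w \in words n 4 -> M a (cell a w) = content a (cell a w).

Definition known (l : seq nat) (M : nat -> seq nat -> R) : Prop :=
  forall a, a \in l -> filled a M.

Lemma known_ignores l a : a \notin l -> ignores a (known l).
Proof.
move=> al M y v kM b bl w wW; rewrite /update; case: (eqVneq b a) bl => [->|_] bl /=; last exact: kM.
by rewrite bl in al.
Qed.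

Lemma known_cons l a M : known l M -> filled a M -> known (a :: l) M.
Proof. by move=> kM aM b; rewrite inE => /predU1P[->|/kM]. Qed.

Lemma known_val l a M (i j k m : nat) : known l M -> a \in l ->
  (i < n)%N -> (j < n)%N -> (k < n)%N -> (m < n)%N ->
  M a (cell a [:: i; j; k; m]) = content a (cell a [:: i; j; k; m]).
Proof. by move=> kM al ii jj kk mm; apply: kM => //; rewrite mem_words /= ii jj kk mm. Qed.

Lemma phase l a e :
  a \notin l ->
  (forall i j k m s, (i < n)%N -> (j < n)%N -> (k < n)%N -> (m < n)%N ->
     int_mem s 2 [::] = i -> int_mem s 3 [::] = j -> int_mem s 4 [::] = k ->
     int_mem s 5 [::] = m -> known l (real_mem s) ->
     reval s e = content a (cell a [:: i; j; k; m])) ->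
  forall ix, (forall s : store R, map (ieval s) ix = cell a [:: int_mem s 2 [::]; int_mem s 3 [::];
                                       int_mem s 4 [::]; int_mem s 5 [::]] :> seq nat) ->
  achieves n (sized n (known l)) (nest a ix e) (nest_cost ix e) (sized n (known (a :: l))).
Proof.
move=> al ev ix ixE; have n0 : (0 < n)%N by apply: ltn_trans n_gt.
have H := @achieves_fill R n n0 a ix e (cell a) (content a) _ (known_ignores al).
move=> s' /H[|t [s2 [ex tB [s2n [K2 F2]]]]]; last first.
  by exists t, s2; split=> //; split=> //; apply: known_cons.
move=> w s + [sn s2 s3 s4 s5] Ks; rewrite ixE mem_words => /andP[/eqP sz].
case: w sz s2 s3 s4 s5 => [|i [|j [|k [|m [|]]]]] //= _ s2 s3 s4 s5.
case/and5P=> ii jj kk mm _; rewrite s2 s3 s4 s5; split=> //.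
exact: (ev i j k m s).
Qed.

Lemma pick2_lt c i : (c < 10)%N -> (pick2 c i < n)%N.
Proof.
by move=> c10; have [_ pc] := pick2P c i; lia.
Qed.

Lemma pick3_lt c i k : (c < 10)%N -> (pick3 c i k < n)%N.
Proof.
by move=> c10; have [_ _ pc] := pick3P c i k; lia.
Qed.

Lemma const_lt c : (c < 10)%N -> (c < n)%N.
Proof. by move=> c10; lia. Qed.

Ltac bound := solve [assumption | by apply: const_lt | by apply: pick2_lt | by apply: pick3_lt].

Section Lookup.

Variables (l : seq nat) (s : store R).
Hypothesis Ks : known l (real_mem s).

Let lookup a i j k m := @known_val l a (real_mem s) i j k m Ks.
Let n0 : (0 < n)%N. Proof. exact: const_lt. Qed.

Lemma look0 i j k m : 0%N \in l -> (i < n)%N -> (j < n)%N -> (k < n)%N -> (m < n)%N ->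
  real_mem s 0 [:: i; j; k; m] = q i j k m.
Proof. by move=> a0 ii jj kk mm; apply: (lookup a0 ii jj kk mm). Qed.
Lemma look2 i j k m : 2 \in l -> (i < n)%N -> (j < n)%N -> (k < n)%N -> (m < n)%N ->
  real_mem s 2 [:: i; j; k; m] = g i j k m.
Proof. by move=> a0 ii jj kk mm; apply: (lookup a0 ii jj kk mm). Qed.
Lemma look3 i j : 3 \in l -> (i < n)%N -> (j < n)%N -> real_mem s 3 [:: i; j] = cand_w g i j.
Proof. by move=> a0 ii jj; apply: (lookup a0 ii jj n0 n0). Qed.
Lemma look4 i j : 4 \in l -> (i < n)%N -> (j < n)%N -> real_mem s 4 [:: i; j] = cand_u g i j.
Proof. by move=> a0 ii jj; apply: (lookup a0 ii jj n0 n0). Qed.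
Lemma look5 i j : 5 \in l -> (i < n)%N -> (j < n)%N -> real_mem s 5 [:: i; j] = cand_A g i j.
Proof. by move=> a0 ii jj; apply: (lookup a0 ii jj n0 n0). Qed.
Lemma look6 i j : 6 \in l -> (i < n)%N -> (j < n)%N -> real_mem s 6 [:: i; j] = cand_D g i j.
Proof. by move=> a0 ii jj; apply: (lookup a0 ii jj n0 n0). Qed.
Lemma look7 i : 7 \in l -> (i < n)%N -> real_mem s 7 [:: i] = cand_t g i.
Proof. by move=> a0 ii; apply: (lookup a0 ii n0 n0 n0). Qed.
Lemma look8 i j k : 8 \in l -> (i < n)%N -> (j < n)%N -> (k < n)%N ->
  real_mem s 8 [:: i; j; k] = cand_tail q i j k.
Proof. by move=> a0 ii jj kk; apply: (lookup a0 ii jj kk n0). Qed.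
Lemma look9 i j k : 9 \in l -> (i < n)%N -> (j < n)%N -> (k < n)%N ->
  real_mem s 9 [:: i; j; k] = cand_head q i j k.
Proof. by move=> a0 ii jj kk; apply: (lookup a0 ii jj kk n0). Qed.

End Lookup.

Definition phases : seq (nat * seq iexpr * rexpr) :=
  [:: (2, [:: vi; vj; vk; vm], reduced_expr); (3, [:: vi; vj], w_expr); (4, [:: vi; vj], u_expr);
      (5, [:: vi; vj], A_expr); (6, [:: vi; vj], D_expr); (7, [:: vi], t_expr);
      (8, [:: vi; vj; vk], tail_expr); (9, [:: vi; vj; vk], head_expr)]%N.

Definition phase_cost (p : nat * seq iexpr * rexpr) : nat := nest_cost p.1.2 p.2.

Lemma reval_reduced i j k m s : (i < n)%N -> (j < n)%N -> (k < n)%N -> (m < n)%N ->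
     int_mem s 2 [::] = i -> int_mem s 3 [::] = j -> int_mem s 4 [::] = k ->
     int_mem s 5 [::] = m -> known [:: 0%N] (real_mem s) ->
     reval s reduced_expr = g i j k m.
Proof.
move=> ii jj kk mm s2 s3 s4 s5 Ks; rewrite /reduced_expr /sym_expr !evalE s2 s3 s4 s5.
by rewrite !(look0 Ks) //; bound.
Qed.

Lemma reval_w i j k m s : (i < n)%N -> (j < n)%N -> (k < n)%N -> (m < n)%N ->
     int_mem s 2 [::] = i -> int_mem s 3 [::] = j -> int_mem s 4 [::] = k ->
     int_mem s 5 [::] = m -> known [:: 2; 0]%N (real_mem s) ->
     reval s w_expr = cand_w g i j.
Proof.
move=> ii jj kk mm s2 s3 s4 s5 Ks; rewrite /w_expr /swap_expr !evalE s2 s3.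
by rewrite !(look2 Ks) //; bound.
Qed.

Lemma reval_u i j k m s : (i < n)%N -> (j < n)%N -> (k < n)%N -> (m < n)%N ->
     int_mem s 2 [::] = i -> int_mem s 3 [::] = j -> int_mem s 4 [::] = k ->
     int_mem s 5 [::] = m -> known [:: 3; 2; 0]%N (real_mem s) ->
     reval s u_expr = cand_u g i j.
Proof.
move=> ii jj kk mm s2 s3 s4 s5 Ks; rewrite /u_expr /swap_expr !evalE s2 s3.
by rewrite !(look2 Ks) ?(look3 Ks) //; bound.
Qed.

Lemma reval_A i j k m s : (i < n)%N -> (j < n)%N -> (k < n)%N -> (m < n)%N ->
     int_mem s 2 [::] = i -> int_mem s 3 [::] = j -> int_mem s 4 [::] = k ->
     int_mem s 5 [::] = m -> known [:: 4; 3; 2; 0]%N (real_mem s) ->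
     reval s A_expr = cand_A g i j.
Proof.
move=> ii jj kk mm s2 s3 s4 s5 Ks; rewrite /A_expr /y_expr !evalE s2 s3.
by rewrite !(look2 Ks) ?(look4 Ks) //; bound.
Qed.

Lemma reval_D i j k m s : (i < n)%N -> (j < n)%N -> (k < n)%N -> (m < n)%N ->
     int_mem s 2 [::] = i -> int_mem s 3 [::] = j -> int_mem s 4 [::] = k ->
     int_mem s 5 [::] = m -> known [:: 5; 4; 3; 2; 0]%N (real_mem s) ->
     reval s D_expr = cand_D g i j.
Proof.
move=> ii jj kk mm s2 s3 s4 s5 Ks; rewrite /D_expr /y_expr !evalE s2 s3.
by rewrite !(look2 Ks) ?(look4 Ks) ?(look5 Ks) //; bound.
Qed.

Lemma reval_t i j k m s : (i < n)%N -> (j < n)%N -> (k < n)%N -> (m < n)%N ->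
     int_mem s 2 [::] = i -> int_mem s 3 [::] = j -> int_mem s 4 [::] = k ->
     int_mem s 5 [::] = m -> known [:: 6; 5; 4; 3; 2; 0]%N (real_mem s) ->
     reval s t_expr = cand_t g i.
Proof.
move=> ii jj kk mm s2 s3 s4 s5 Ks; rewrite /t_expr /y_expr !evalE s2.
by rewrite !(look2 Ks) ?(look4 Ks) ?(look5 Ks) ?(look6 Ks) //; bound.
Qed.

Lemma reval_tail i j k m s : (i < n)%N -> (j < n)%N -> (k < n)%N -> (m < n)%N ->
     int_mem s 2 [::] = i -> int_mem s 3 [::] = j -> int_mem s 4 [::] = k ->
     int_mem s 5 [::] = m -> known [:: 7; 6; 5; 4; 3; 2; 0]%N (real_mem s) ->
     reval s tail_expr = cand_tail q i j k.
Proof.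
move=> ii jj kk mm s2 s3 s4 s5 Ks.
rewrite /tail_expr /sym_expr /neg_expr !evalE s2 s3 s4.
rewrite !(look0 Ks) ?(look4 Ks) ?(look5 Ks) ?(look7 Ks) //; try bound.
by rewrite /cand_tail /tail_split !sub0r.
Qed.

Lemma reval_head i j k m s : (i < n)%N -> (j < n)%N -> (k < n)%N -> (m < n)%N ->
     int_mem s 2 [::] = i -> int_mem s 3 [::] = j -> int_mem s 4 [::] = k ->
     int_mem s 5 [::] = m -> known [:: 8; 7; 6; 5; 4; 3; 2; 0]%N (real_mem s) ->
     reval s head_expr = cand_head q i j k.
Proof.
move=> ii jj kk mm s2 s3 s4 s5 Ks.
rewrite /head_expr /sym_expr /neg_expr !evalE s2 s3 s4.
rewrite !(look0 Ks) ?(look4 Ks) ?(look6 Ks) ?(look7 Ks) //; try bound.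
by rewrite /cand_head /head_split !sub0r.
Qed.

Lemma achieves_phases :
  achieves n (sized n (known [:: 0%N]))
    (Seq (nest 2 [:: vi; vj; vk; vm] reduced_expr) (Seq (nest 3 [:: vi; vj] w_expr)
    (Seq (nest 4 [:: vi; vj] u_expr) (Seq (nest 5 [:: vi; vj] A_expr)
    (Seq (nest 6 [:: vi; vj] D_expr) (Seq (nest 7 [:: vi] t_expr)
    (Seq (nest 8 [:: vi; vj; vk] tail_expr) (nest 9 [:: vi; vj; vk] head_expr))))))))
    (sumn (map phase_cost phases))
    (sized n (known [:: 9; 8; 7; 6; 5; 4; 3; 2; 0]%N)).
Proof.
have Hr := @phase [:: 0%N] 2 _ isT reval_reduced [:: vi; vj; vk; vm] (fun _ => erefl).
have Hw := @phase [:: 2; 0]%N 3 _ isT reval_w [:: vi; vj] (fun _ => erefl).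
have Hu := @phase [:: 3; 2; 0]%N 4 _ isT reval_u [:: vi; vj] (fun _ => erefl).
have HA := @phase [:: 4; 3; 2; 0]%N 5 _ isT reval_A [:: vi; vj] (fun _ => erefl).
have HD := @phase [:: 5; 4; 3; 2; 0]%N 6 _ isT reval_D [:: vi; vj] (fun _ => erefl).
have Ht := @phase [:: 6; 5; 4; 3; 2; 0]%N 7 _ isT reval_t [:: vi] (fun _ => erefl).
have Ha := @phase [:: 7; 6; 5; 4; 3; 2; 0]%N 8 _ isT reval_tail [:: vi; vj; vk] (fun _ => erefl).
have Hb := @phase [:: 8; 7; 6; 5; 4; 3; 2; 0]%N 9 _ isT reval_head [:: vi; vj; vk] (fun _ => erefl).
rewrite /phases /= /phase_cost /= addn0.
do ![apply: achieves_seq; first by eassumption].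
exact: Hb.
Qed.

End Facts.

(** * The test and the output matrix for large n *)

Section LargeSize.

Variables (R : realType) (n : nat) (q : nat -> nat -> nat -> nat -> R).
Hypothesis n_gt : (50 < n)%N.

Local Notation a := (cand_tail q).
Local Notation b := (cand_head q).

Let n_gt0 : (0 < n)%N. Proof. exact: const_lt. Qed.

Definition penalty (w : seq nat) : R :=
  let i := nth 0%N w 0 in let j := nth 0%N w 1 in
  let k := nth 0%N w 2 in let m := nth 0%N w 3 in
  (1 - (i == j)%:R) * (1 - (k == m)%:R) * ((1 - (i == k)%:R) * (1 - (j == m)%:R)
    * (1 - (i == m)%:R * (j == k)%:R))
  * ((sym_cost q i j k m - splits a b i j k m) * (sym_cost q i j k m - splits a b i j k m)).

Definition coef_term (w : seq nat) : R :=
  let i := nth 0%N w 0 in let j := nth 0%N w 1 in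
  let k := nth 0%N w 2 in let m := nth 0%N w 3 in
  (m == 0)%N%:R * ((1 - (k == i)%:R) * a i j k + (1 - (k == j)%:R) * b i j k).

(** The summands are nonnegative, so a single comparison decides all the equations. *)
Lemma penalty_eq0 : \sum_(w <- words n 4) penalty w <= 0 <->
  forall i j k m, [&& i < n, j < n, k < n & m < n]%N -> compatible i j k m ->
    sym_cost q i j k m = splits a b i j k m.
Proof.
have pE i j k m : penalty [:: i; j; k; m] =
    if compatible i j k m then (sym_cost q i j k m - splits a b i j k m) ^+ 2 else 0.
  have [t1 f0] : (true%:R = 1 :> R) /\ (false%:R = 0 :> R) by [].
  rewrite /penalty /= /compatible -expr2; case: (i == j); case: (k == m);
  case: (i == k); case: (j == m); case: (i == m); case: (j == k) => /=;
  rewrite ?t1 ?f0; ring.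
have p0 w : w \in words n 4 -> 0 <= penalty w.
  rewrite mem_words; case: w => [|i [|j [|k [|m [|]]]]] //= _.
  by rewrite pE; case: ifP => // _; apply: sqr_ge0.
have sum0 : 0 <= \sum_(w <- words n 4) penalty w.
  by rewrite big_seq sumr_ge0.
have -> : \sum_(w <- words n 4) penalty w <= 0 <-> \sum_(w <- words n 4) penalty w == 0.
  by rewrite eq_le sum0 andbT.
rewrite big_seq psumr_eq0; last by move=> w wW; apply: p0.
split=> [/allP all0 i j k m ijkm comp|ok].
  have wW : [:: i; j; k; m] \in words n 4.
    by rewrite mem_words /=; case/and4P: ijkm => -> -> -> ->.
  have := all0 _ wW; rewrite wW pE comp /= sqrf_eq0 subr_eq0 => /eqP //.
apply/allP => w wW; apply/implyP => _; move: wW; rewrite mem_words.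
case: w => [|i [|j [|k [|m [|]]]]] //= /and5P[ii jj kk mm _].
rewrite pE; case: ifP => // comp.
by rewrite (ok i j k m) ?subrr ?expr0n //; apply/and4P.
Qed.

Lemma sum_coef_term i j : (i < n)%N -> (j < n)%N ->
  q i j i j + \sum_(w <- words n 4 | cell 1 w == [:: i; j]) coef_term w
  = split_coef n q a b i j.
Proof.
move=> ii jj; rewrite /split_coef -addrA; congr (_ + _).
rewrite big_mkcond sum_words //.
transitivity (\sum_(i' <- iota 0 n) (if i' == i then \sum_(j' <- iota 0 n)
   (if j' == j then \sum_(k <- iota 0 n) \sum_(m <- iota 0 n) 
     (if m == 0%N then (1 - (k == i)%:R) * a i j k + (1 - (k == j)%:R) * b i j k else 0)
    else 0) else 0)).
  apply: eq_bigr => i' _; case: (eqVneq i' i) => [->|ni]; last first.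
    rewrite big1 // => j' _; rewrite big1 // => k _; rewrite big1 // => m _.
    by rewrite /= eqseq_cons (negbTE ni).
  apply: eq_bigr => j' _; case: (eqVneq j' j) => [->|nj]; last first.
    rewrite big1 // => k _; rewrite big1 // => m _.
    by rewrite /= !eqseq_cons (negbTE nj) andbF.
  apply: eq_bigr => k _; apply: eq_bigr => m _.
  rewrite /= eqxx /coef_term /=; case: (m == 0%N); rewrite ?mul1r ?mul0r //.
rewrite !sum_iota_eq //.
have simp x y (F : R) : (1 - (x == y :> nat)%:R) * F = if x != y then F else 0.
  by case: (x == y); rewrite ?subrr ?mul0r // subr0 mul1r.
rewrite [X in X + _]big_mkcond [X in _ + X]big_mkcond -big_split.
by apply: eq_bigr => k _; rewrite sum_iota_eq // !simp.
Qed.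

Definition known_arrays : seq nat := [:: 9; 8; 7; 6; 5; 4; 3; 2; 0]%N.

Definition total_penalty := \sum_(w <- words n 4) penalty w.

Definition outcome (M : nat -> seq nat -> R) : Prop :=
  M 10 [::] = total_penalty /\
  forall i j, (i < n)%N -> (j < n)%N -> M 1 [:: i; j] = split_coef n q a b i j.

Definition linearize : cmd :=
  Seq (Seq (nest 2 [:: vi; vj; vk; vm] reduced_expr) (Seq (nest 3 [:: vi; vj] w_expr)
    (Seq (nest 4 [:: vi; vj] u_expr) (Seq (nest 5 [:: vi; vj] A_expr)
    (Seq (nest 6 [:: vi; vj] D_expr) (Seq (nest 7 [:: vi] t_expr)
    (Seq (nest 8 [:: vi; vj; vk] tail_expr) (nest 9 [:: vi; vj; vk] head_expr))))))))
  (Seq (nest 10 [::] (ROfInt 0%:c)) (Seq (nest 10 [::] penalty_expr)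
  (Seq (nest 1 [:: vi; vj] (RGet 0 [:: vi; vj; vi; vj])) (nest 1 [:: vi; vj] coef_expr)))).

Definition linearize_cost : nat :=
  (sumn (map phase_cost phases) + (nest_cost [::] (ROfInt 0%:c) +
   (nest_cost [::] penalty_expr + (nest_cost [:: vi; vj] (RGet 0 [:: vi; vj; vi; vj])
    + nest_cost [:: vi; vj] coef_expr))))%N.

Lemma achieves_linearize :
  achieves n (sized n (known n q [:: 0%N])) linearize linearize_cost (sized n outcome).
Proof.
rewrite /linearize /linearize_cost.
apply: (achieves_seq (achieves_phases (q := q) n_gt)).
have ign10 : ignores 10 (known n q known_arrays) by apply: known_ignores.
pose G M := known n q known_arrays M /\ M 10 [::] = total_penalty.
have ign1 : ignores 1 G.
  by move=> M y v [kM M10]; split; [apply: known_ignores | rewrite /update].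
apply: achieves_seq (achieves_fill n_gt0 (jx := cell 10) (val := fun _ => 0) ign10 _) _.
  by move=> w s _ _ _.
have vars w (s : store R) : w \in words n 4 -> loop_vars n w s -> 
    exists i j k m, [/\ w = [:: i; j; k; m], [&& i < n, j < n, k < n & m < n]%N
      & [/\ int_mem s 2 [::] = i, int_mem s 3 [::] = j, int_mem s 4 [::] = k
          & int_mem s 5 [::] = m]].
  rewrite mem_words => /andP[/eqP sz]; case: w sz => [|i [|j [|k [|m [|]]]]] //= _.
  by case/and5P=> ii jj kk mm _ [/= _ s2 s3 s4 s5]; exists i, j, k, m; split=> //; apply/and4P.
apply: achieves_seq (achieves_sum n_gt0 (jx := cell 10) (h := penalty) (m0 := fun _ => 0)
  (a := 10) (ix := [::]) (e := penalty_expr) ign10 _) _.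
  move=> w s wW lv Ks; split=> //.
  have [i [j [k [m [-> /and4P[ii jj kk mm] [s2 s3 s4 s5]]]]]] := vars w s wW lv.
  rewrite /penalty_expr /compatible_expr /residue_expr /sym_expr !evalE s2 s3 s4 s5.
  by rewrite !(look0 Ks) ?(look8 n_gt Ks) ?(look9 n_gt Ks).
(* All words address the one cell of array 10, so its sum runs over all quadruples. *)
have step s : sized n (fun M => known n q known_arrays M /\ forall w, w \in words n 4 ->
    M 10%N (cell 10 w) = 0 + \sum_(w' <- words n 4 | cell 10 w' == cell 10 w) penalty w') s ->
    sized n G s.
  case=> sn [Ks Ps]; split=> //; split=> //.
  rewrite (Ps [:: 0; 0; 0; 0]%N) ?add0r; last by rewrite mem_words /= n_gt0.
  by rewrite /total_penalty; apply: eq_bigl => w.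
move=> s /step {step}; apply: achieves_seq.
  apply: (achieves_fill n_gt0 (jx := cell 1) (val := content q 1) ign1).
  move=> w s' wW lv [Ks _].
  have [i [j [k [m [-> /and4P[ii jj kk mm] [s2 s3 s4 s5]]]]]] := vars w s' wW lv.
  by rewrite !evalE s2 s3 !(look0 Ks).
move=> s1 /(achieves_sum n_gt0 (jx := cell 1) (h := coef_term) (e := coef_expr)
   (ix := [:: vi; vj]) ign1)[|t [s2 [ex tB [s2n [[_ s10] C]]]]].
  move=> w s' wW lv [Ks _].
  have [i [j [k [m [-> /and4P[ii jj kk mm] [s2 s3 s4 s5]]]]]] := vars w s' wW lv.
  rewrite /coef_expr !evalE s2 s3 s4 s5; split=> //.
  by rewrite (look8 n_gt Ks) ?(look9 n_gt Ks).
exists t, s2; split=> //; split=> //; split=> // i j ii jj.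
rewrite -sum_coef_term //; apply: (C [:: i; j; 0; 0]%N).
by rewrite mem_words /= ii jj n_gt0.
Qed.

End LargeSize.

(** * The complete program *)

Definition solver : cmd :=
  Seq linearize
    (If (TRLe (RGet 10 [::]) (ROfInt 0%:c)) (ISet 1 [::] 1%:c) (ISet 1 [::] 0%:c)).

(** The 7 pays for the final comparison and for writing the answer. *)
Lemma solver_correct (R : realType) (n : nat) : (50 < n)%N ->
  solves R n solver ((linearize_cost + 7) * n ^ 5).
Proof.
move=> n_gt Q s [sn inQ].
(* Where [(i, j)] or [(k, m)] is no arc, [q] is arbitrary memory; the splitting condition concerns
   compatible pairs only. *)
pose q i j k m := real_mem s 0 [:: i; j; k; m].
have Qq e f : Q (e, f) = q (val (arc_tail e)) (val (arc_head e))
                           (val (arc_tail f)) (val (arc_head f)) by rewrite -inQ.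
have ks : sized n (known n q [:: 0%N]) s.
  by split=> // x; rewrite inE => /eqP -> w _.
have [t [s1 [ex tB [s1n [s1p s1C]]]]] := achieves_linearize n_gt ks.
have n2 : (2 < n)%N by apply: ltn_trans n_gt.
pose ok := real_mem s1 10 [::] <= 0.
have okE : ok <-> forall i j k m, [&& i < n, j < n, k < n & m < n]%N ->
    compatible i j k m -> sym_cost q i j k m = splits (cand_tail q) (cand_head q) i j k m.
  by rewrite /ok s1p; apply: penalty_eq0.
have okL : ok <-> linearizable Q.
  split=> [/okE sp|lin]; last by apply/okE; apply: linearizable_split lin.
  by eexists; apply: split_linearization sp.
pose s2 := Store (update (int_mem s1) 1 [::] ok) (real_mem s1).
exists (t + (tcost (TRLe (RGet 10 [::]) (ROfInt 0%:c)) + 2).+1)%N, s2; split.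
- apply: ExecSeq ex _; apply: ExecIf.
  have -> : teval s1 (TRLe (RGet 10 [::]) (ROfInt 0%:c)) = ok by [].
  by rewrite /s2; case: (ok); apply: (ExecISet s1 1 [::] (IConst _)).
- have n0 : (0 < n)%N by apply: ltn_trans n_gt.
  rewrite mulnDl; apply: leq_add.
    by apply: leq_trans tB _; rewrite leq_mul2l leq_pexp2l ?orbT.
  by rewrite -[X in (X <= _)%N]muln1 leq_mul // expn_gt0 n0.
- by rewrite /answers_yes /= /update /= eqb0 negbK.
move=> lin; have sp := okE.1 (okL.2 lin).
move=> tau ttau; rewrite (split_linearization Qq n2 sp ttau).
by apply: eq_bigr => e _; rewrite [LHS]mxE [RHS]mxE; symmetry; apply: s1C; apply: ltn_ord.
Qed.

(** One program must serve all n, so the small sizes are wired in one at a time behind a test of n.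
    Each step lowers the threshold by one, and [d < N] keeps it positive. *)
Lemma dispatch (R : realType) (p : cmd) (K N : nat) :
  (forall n, (N <= n)%N -> solves R n p (K * n ^ 5)) ->
  forall d, (d < N)%N -> exists p' K', forall n, (N - d <= n)%N -> solves R n p' (K' * n ^ 5).
Proof.
move=> sp; elim=> [|d IHd] dN; first by exists p, K; rewrite subn0.
have [p' [K' sp']] := IHd (ltnW dN).
have [c [Kc sc]] := solves_fixed R (N - d.+1).
exists (If (TILe (var 0) (IConst (N - d.+1))) c p'), (K' + Kc + 4)%N => n nd Q s inQ.
have n0 : (0 < n)%N by apply: leq_trans nd; rewrite subn_gt0.
have n5 : (0 < n ^ 5)%N by rewrite expn_gt0 n0.
(* Since n is at least [N - d.+1], this comparison amounts to an equality test. *)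
case: (leqP n (N - d.+1)) => [nle|ngt].
  have nE : n = (N - d.+1)%N by apply/eqP; rewrite eqn_leq nle nd.
  rewrite -nE in sc; have [t [s' [ex tB yes lin]]] := sc Q s inQ.
  exists (3 + t).+1, s'; split=> //.
    by apply: ExecIf; rewrite /= inQ.1 nle.
  by nia.
have nge : (N - d <= n)%N by rewrite -(subnSK dN) in ngt *; lia.
have [t [s' [ex tB yes lin]]] := sp' n nge Q s inQ.
exists (3 + t).+1, s'; split=> //.
  by apply: ExecIf; rewrite /= inQ.1 leqNgt ngt.
by nia.
Qed.

Theorem theorem7 (R : realType) :
  exists (p : cmd) (K : nat),
    forall (n : nat) (Q : {ffun diarc n * diarc n -> R}) (s : store R),
      (0 < n)%N -> holds_input Q s ->
      exists (t : nat) (s' : store R),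
        [/\ exec p s t s',
            (t <= K * n ^ 5)%N,
            answers_yes s' <-> linearizable Q
          & linearizable Q -> is_linearization Q (output_matrix n s')].
Proof.
(* With [N] = 51 and [d] = 50 the threshold [N - d] is 1. *)
have [p [K sp]] := dispatch (@solver_correct R) (erefl : (50 < 51)%N).
by exists p, K => n Q s n0; apply: sp.
Qed.
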